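(* Let $(\Omega,\Sigma,\mu)$ be a $\sigma$-finite measure space and $\gamma=\mu(\Omega)\in(0,\infty]$. Let $\psi:[0,\gamma)\to[0,\infty)$ be a non-zero increasing concave function, continuous on $(0,\gamma)$, with $\psi(0)=0$, satisfying either condition (A) or condition (B). Then the Marcinkiewicz space $M_\psi(\mu)$ over $(\Omega,\Sigma,\mu)$ is a Grothendieck space.
   Context: For $f\in L_0(\mu)$, $f^*(t)=\inf\{s\ge0:\mu(\{|f|>s\})\le t\}$. $M_\psi(\mu)=\{f\in L_0(\mu):\|f\|_{M_\psi(\mu)}<\infty\}$, where $\|f\|_{M_\psi(\mu)}=\sup_{0<t<\gamma}\frac{1}{\psi(t)}\int_0^t f^*(s)\,ds$. Condition (A): $\gamma=\infty$ and $\liminf_{t\downarrow0}\psi(2t)/\psi(t)>1$ and $\liminf_{t\to\infty}\psi(2t)/\psi(t)>1$. Condition (B): $\gamma<\infty$ and $\liminf_{t\downarrow0}\psi(2t)/\psi(t)>1$. A Banach space $X$ is a Grothendieck space if every weak-$*$ convergent sequence in $X^*$ converges weakly. *)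

(* Defs.v *)
From HB Require Import structures.
From mathcomp Require Import all_boot all_order all_algebra.
From mathcomp Require Import all_classical all_reals all_analysis.
Set Implicit Arguments. Unset Strict Implicit. Unset Printing Implicit Defensive.
Import Order.TTheory GRing.Theory Num.Theory.
Import numFieldNormedType.Exports.
Local Open Scope classical_set_scope.
Local Open Scope ring_scope.

Section Marcinkiewicz.
Context {R : realType} {d : measure_display} {T : measurableType d}.
Variable mu : {measure set T -> \bar R}.

(* decreasing rearrangement f^*(t) = inf { s >= 0 : mu(|f| > s) <= t } (inf of empty set = +oo) *)
Definition drearr (f : T -> R) (t : R) : \bar R :=
  ereal_inf [set s%:E | s in [set s : R | (0 <= s)%R /\ (mu [set x | (s < `|f x|)%R] <= t%:E)%E]].

Definition gamma_itv : set R := [set t : R | 0 < t /\ (t%:E < mu setT)%E].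

Definition Mnorm (psi : R -> R) (f : T -> R) : \bar R :=
  ereal_sup [set ((psi t)^-1)%:E *
     (\int[lebesgue_measure]_(s in [set s : R | (0 < s < t)%R]) drearr f s)
     | t in gamma_itv]%E.

(* M_psi(mu): measurable (L_0) functions with finite Marcinkiewicz norm.
   Functions equal a.e. are identified implicitly: they have zero-norm difference. *)
Definition Mspace (psi : R -> R) : set (T -> R) :=
  [set f | measurable_fun setT f /\ (Mnorm psi f < +oo)%E].

Definition Mdual (psi : R -> R) : set ((T -> R) -> R) :=
  [set phi | (forall (a : R) f g, Mspace psi f -> Mspace psi g ->
                 phi (a \*: f \+ g) = a * phi f + phi g) /\
             exists C : R, forall f, Mspace psi f -> `|phi f| <= C * fine (Mnorm psi f)].

Definition Mdualnorm (psi : R -> R) (phi : (T -> R) -> R) : R :=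
  fine (ereal_sup [set `|phi f|%:E | f in [set f | Mspace psi f /\ (Mnorm psi f <= 1)%E]]).

Definition Mbidual (psi : R -> R) : set (((T -> R) -> R) -> R) :=
  [set Phi | (forall (a : R) phi chi, Mdual psi phi -> Mdual psi chi ->
                 Phi (a \*: phi \+ chi) = a * Phi phi + Phi chi) /\
             exists C : R, forall phi, Mdual psi phi -> `|Phi phi| <= C * Mdualnorm psi phi].

Definition Mpsi_Grothendieck (psi : R -> R) : Prop :=
  forall (phis : nat -> (T -> R) -> R) (phi : (T -> R) -> R),
    (forall n, Mdual psi (phis n)) -> Mdual psi phi ->
    (forall f, Mspace psi f -> phis n f @[n --> \oo] --> phi f) ->
    forall Phi, Mbidual psi Phi -> Phi (phis n) @[n --> \oo] --> Phi phi.

End Marcinkiewicz.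

Definition concave_on {R : realType} (A : set R) (psi : R -> R) : Prop :=
  forall x y (l : R), A x -> A y -> 0 <= l <= 1 ->
    l * psi x + (1 - l) * psi y <= psi (l * x + (1 - l) * y).

Definition liminf0_gt1 {R : realType} (psi : R -> R) : Prop :=
  exists2 c : R, 1 < c & \forall t \near 0^'+, c < psi (2 * t) / psi t.

Definition liminfoo_gt1 {R : realType} (psi : R -> R) : Prop :=
  exists2 c : R, 1 < c & \forall t \near +oo, c < psi (2 * t) / psi t.

(* Main.v *)
(** The growth conditions on [psi] make [M_psi] a quotient of an [l^oo]-sum of scaled copies of
    [L^1 /\ L^oo]: the unit ball consists, up to constants, of the sums [\sum_j b ^ (j + 1) * y_j]
    over [j : int] with [|y_j| <= 1] and [\int |y_j| <= level j], the [j]-th slice of [f] being its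
    restriction to [b ^ j < |f| <= b ^ (j + 1)].

    Let [phi_i] be weak-* null and suppose that [Phi (phi_i) >= e > 0] for some [Phi] in the bidual.
    By Helly's theorem there are [y_N] in the ball with [phi_i (y_N) >= e'] for all [i <= N]. The
    norms of the [phi_i] restricted to sets of scales are uniformly absolutely continuous by
    Rosenthal's lemma and the Vitali-Hahn-Saks argument, since elements with disjoint scales glue.
    By the parallelogram law the convex sets [{y | phi_i (y) >= e' for i <= N}] contain elements
    whose differences [z] are small in quadratic mean, for Lebesgue-type means on the scales as well
    as for finitely many [|phi_i|]. Up to parts that are small for all the [phi_i], such a [z] lives
    on a set [A] of small measure at every scale. Hence a sequence of such sets has its union [E]
    in the space, and on the order interval of [\1_E] a second Vitali-Hahn-Saks argument
    contradicts the lower bound for [phi_i (z)]. *)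
Require Import Defs.
From HB Require Import structures.
From mathcomp Require Import all_boot all_order all_algebra.
From mathcomp Require Import all_classical all_reals all_analysis.
From mathcomp Require Import measurable_realfun ring lra.
Set Implicit Arguments. Unset Strict Implicit. Unset Printing Implicit Defensive.
Import Order.TTheory GRing.Theory Num.Theory.
Import numFieldNormedType.Exports.
Local Open Scope classical_set_scope.
Local Open Scope ring_scope.

(** * Linear functionals on subspaces *)

Section LinearOn.
Variables (R : pzRingType) (V : lmodType R).
Implicit Types (Y : set V) (phi : V -> R) (a : R) (y z : V).

Definition linear_on Y phi := forall a y z, Y y -> Y z ->
  phi (a *: y + z) = a * phi y + phi z.

Definition linear_subspace Y := Y 0 /\
  forall a y z, Y y -> Y z -> Y (a *: y + z).

Section Subspace.
Variable Y : set V.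
Hypothesis subY : linear_subspace Y.

Lemma linear_subspace0 : Y 0.
Proof. by have [] := subY. Qed.

Lemma linear_subspaceD y z : Y y -> Y z -> Y (y + z).
Proof. by move=> Yy Yz; rewrite -[y]scale1r; exact: subY.2. Qed.

Lemma linear_subspaceZ a y : Y y -> Y (a *: y).
Proof. by move=> Yy; rewrite -[a *: y]addr0; apply: subY.2 => //; exact: subY.1. Qed.

Lemma linear_subspaceB y z : Y y -> Y z -> Y (y - z).
Proof. by move=> Yy Yz; rewrite addrC -scaleN1r; exact: subY.2. Qed.

Lemma linear_subspace_sum (I : Type) (r : seq I) (y : I -> V) :
  (forall i, Y (y i)) -> Y (\sum_(i <- r) y i).
Proof.
move=> Yy; elim/big_ind : _ => //; first exact: linear_subspace0.
exact: linear_subspaceD.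
Qed.

Variable phi : V -> R.
Hypothesis phi_lin : linear_on Y phi.

Lemma linear_onD y z : Y y -> Y z -> phi (y + z) = phi y + phi z.
Proof. by move=> Yy Yz; rewrite -{1}[y]scale1r phi_lin// mul1r. Qed.

Lemma linear_on0 : phi 0 = 0.
Proof.
have Y0 := linear_subspace0.
by apply: (@addrI _ (phi 0)); rewrite -linear_onD// !addr0.
Qed.

Lemma linear_onZ a y : Y y -> phi (a *: y) = a * phi y.
Proof.
move=> Yy; have Y0 := linear_subspace0.
by rewrite -[a *: y]addr0 phi_lin// linear_on0 addr0.
Qed.

Lemma linear_onN y : Y y -> phi (- y) = - phi y.
Proof. by move=> Yy; rewrite -scaleN1r linear_onZ// mulN1r. Qed.

Lemma linear_onB y z : Y y -> Y z -> phi (y - z) = phi y - phi z.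
Proof. by move=> Yy Yz; rewrite addrC -scaleN1r phi_lin// mulN1r addrC. Qed.

Lemma linear_on_sum (I : Type) (r : seq I) (a : I -> R) (y : I -> V) :
  (forall i, Y (y i)) ->
  phi (\sum_(i <- r) a i *: y i) = \sum_(i <- r) a i * phi (y i).
Proof.
move=> Yy; elim: r => [|i r IH]; first by rewrite !big_nil linear_on0.
rewrite !big_cons phi_lin ?IH//; apply: linear_subspace_sum => j.
exact: linear_subspaceZ.
Qed.

End Subspace.
End LinearOn.

Lemma exprn_unbounded (R : realType) (c x : R) : 1 < c -> exists n, x < c ^+ n.
Proof.
move=> c1; have c0 : 0 < c by exact: lt_trans c1.
have [x0|x0] := leP x 0; first by exists 0%N; rewrite (le_lt_trans x0).
have /(cvg_geometric x)/cvgrPdist_lt/(_ _ ltr01)[n _ /(_ n)] : `|c^-1| < 1.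
  by rewrite gtr0_norm ?invr_gt0// invf_lt1.
rewrite /= sub0r normrN normrM exprVn normfV !gtr0_norm ?exprn_gt0// => /(_ (leqnn n)).
by rewrite ltr_pdivrMr ?exprn_gt0// mul1r; exists n.
Qed.

Lemma invr_expr2_lt (R : realType) (e : R) : 0 < e -> exists n : nat, 2 ^- n < e.
Proof.
move=> e0; have [|n hn] := @exprn_unbounded R 2 e^-1; first by rewrite ltr1n.
by exists n; rewrite -[e]invrK ltf_pV2 ?posrE ?exprn_gt0 ?invr_gt0.
Qed.

Lemma sum_invr_expr2_le (R : realType) n : \sum_(l < n) (2 : R) ^- l <= 2.
Proof.
have := @geometric_le_lim R n 1 2^-1 ler01.
rewrite invr_gt0 gtr0_norm ?invr_gt0// invf_lt1// ltr1n ltr0n => /(_ isT isT).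
rewrite /series/= big_mkord (_ : 1 / (1 - 2^-1) = 2); last by field.
by rewrite (eq_bigr (fun l : 'I_n => 2 ^- l)) // => l _; rewrite /= mul1r exprVn.
Qed.

Section Content.
Variables (R : realType) (U : Type) (F : set (set U)).

Definition content_on (m : set U -> R) :=
  (forall A, F A -> 0 <= m A) /\
  (forall A B, F A -> F B -> A `&` B = set0 -> m (A `|` B) = m A + m B).

Variable m : set U -> R.
Hypotheses (ringF : setring F) (contm : content_on m).
Let F0 : F set0. Proof. by case: ringF. Qed.
Let FU : setU_closed F. Proof. by case: ringF. Qed.
Let FD : setD_closed F. Proof. by case: ringF. Qed.

Lemma setring_bigsetU (A : nat -> set U) n : (forall k, F (A k)) ->
  F (\big[setU/set0]_(k < n) A k).
Proof. by move=> FA; elim/big_ind : _ => //; exact: FU. Qed.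

Lemma content_on0 : m set0 = 0.
Proof. by apply: (@addrI _ (m set0)); rewrite -contm.2 ?setI0// setU0 addr0. Qed.

Lemma le_content_on A B : F A -> F B -> A `<=` B -> m A <= m B.
Proof.
move=> FA FB AB; rewrite -(setDUK AB) contm.2 ?setDIK//; last exact: FD.
by rewrite lerDl contm.1//; exact: FD.
Qed.

Lemma content_on_setU_le A B : F A -> F B -> m (A `|` B) <= m A + m B.
Proof.
move=> FA FB; have FAUB : F ((A `|` B) `\` B) by apply: FD => //; exact: FU.
rewrite -(setDUK (@subsetUr _ A B)) contm.2 ?setDIK// addrC lerD2r.
by apply: le_content_on => //; rewrite setDUl setDv setU0; exact: subDsetl.
Qed.

Lemma content_on_le_setD A B : F A -> F B -> m A <= m (A `\` B) + m B.
Proof.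
move=> FA FB; have FAB := FD FA FB.
apply: le_trans (content_on_setU_le FAB FB); apply: le_content_on => //.
  exact: FU.
by move=> x Ax; have [Bx|nBx] := pselect (B x); [right|left].
Qed.

Lemma content_on_bigsetU_le (A : nat -> set U) n : (forall k, F (A k)) ->
  m (\big[setU/set0]_(k < n) A k) <= \sum_(k < n) m (A k).
Proof.
move=> FA; elim: n => [|n IH]; first by rewrite !big_ord0 content_on0.
rewrite !big_ord_recr/=.
by apply: (le_trans (content_on_setU_le (setring_bigsetU n FA) (FA n))); rewrite lerD2r.
Qed.

Lemma content_on_bigsetU (A : nat -> set U) n : (forall k, F (A k)) ->
  trivIset setT A -> m (\big[setU/set0]_(k < n) A k) = \sum_(k < n) m (A k).
Proof.
move=> FA tA; elim: n => [|n IH]; first by rewrite !big_ord0 content_on0.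
rewrite !big_ord_recr/= contm.2 ?IH//; first exact: setring_bigsetU.
rewrite -subset0 -bigcup_mkord => x [[k /= kn Ak] An].
by move: kn; rewrite (tA k n)// ?ltnn//; exists x.
Qed.

End Content.

(** * The Vitali-Hahn-Saks argument *)

Section VitaliHahnSaks.
Variables (R : realType) (U : Type) (F : set (set U)).
Hypothesis sigmaF : sigma_ring F.
Let F0 : F set0. Proof. by case: sigmaF. Qed.
Let FD : setD_closed F. Proof. by case: sigmaF. Qed.
Let Fbigcup (A : nat -> set U) : (forall n, F (A n)) -> F (\bigcup_n A n).
Proof. by case: sigmaF => _ _; exact. Qed.

Lemma sigma_ring_setring : setring F.
Proof.
by split => // A B FA FB; rewrite -bigcup2E; apply: Fbigcup => -[|[|n]] /=.
Qed.
Let ringF := sigma_ring_setring.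
Let FU : setU_closed F. Proof. by case: ringF. Qed.

Lemma sigma_ring_bigcup (P : set nat) (A : nat -> set U) :
  (forall n, F (A n)) -> F (\bigcup_(n in P) A n).
Proof. by move=> FA; rewrite bigcup_mkcond; apply: Fbigcup => n; case: ifP. Qed.

Section Rosenthal.
Implicit Types (mu : nat -> set U -> R) (D : nat -> set U) (e : R).

(* Arrange the indices in infinitely many infinite blocks. If every block contains a bad index,
   then the bad indices themselves form the second subsequence. *)
Lemma rosenthal_dichotomy mu D e : (forall k, content_on F (mu k)) ->
  (forall n, F (D n)) -> trivIset setT D ->
  (exists2 f : nat -> nat, injective f &
    forall k, mu (f k) (\bigcup_(l in [set~ k]) D (f l)) <= e) \/
  (exists2 f : nat -> nat, injective f &
    forall k, mu (f k) (\bigcup_l D (f l)) + e <= mu (f k) (\bigcup_l D l)).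
Proof.
move=> cmu FDn tD; pose g (p q : nat) := pickle (p, q).
have ginj p q p' q' : g p q = g p' q' -> (p, q) = (p', q') by move/(pcan_inj pickleK).
have [[p hp]|bad] := pselect (exists p, forall q,
    mu (g p q) (\bigcup_(l in [set~ q]) D (g p l)) <= e).
  by left; exists (g p) => // q q' /ginj[].
have /choice[q hq] p : exists q, e < mu (g p q) (\bigcup_(l in [set~ q]) D (g p l)).
  apply: contrapT => h; apply: bad; exists p => q.
  by rewrite leNgt; apply/negP => h'; apply: h; exists q.
right; exists (fun p => g p (q p)) => [p p' /ginj[]//|p].
set A := \bigcup_l _; set B := \bigcup_(l in [set~ q p]) D (g p l).
have FA : F A by exact: sigma_ring_bigcup.
have FB : F B by exact: sigma_ring_bigcup.
have AB0 : A `&` B = set0.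
  rewrite -subset0 => x [[p' _ Dx] [l /= lq Dl]]; apply: lq.
  have : (p', q p') = (p, l) by apply/ginj/(tD _ _ I I); exists x.
  by move=> [-> ->].
apply: (@le_trans _ _ (mu (g p (q p)) (A `|` B))).
  by rewrite (cmu _).2// lerD2l ltW// hq.
apply: (le_content_on ringF (cmu _)); [exact: FU|exact: sigma_ring_bigcup|].
by move=> x [[l _ Dl]|[l _ Dl]]; [exists (g l (q l))|exists (g p l)].
Qed.

Lemma rosenthal mu D C e : (forall k, content_on F (mu k)) ->
  (forall k A, F A -> mu k A <= C) -> (forall n, F (D n)) -> trivIset setT D -> 0 < e ->
  exists2 f : nat -> nat, injective f &
    forall k, mu (f k) (\bigcup_(l in [set~ k]) D (f l)) <= e.
Proof.
move=> cmu muC FDn tD e0.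
have [n Cn] : exists n : nat, C <= n%:R * e.
  by exists (Num.truncn (C / e)).+1; rewrite -ler_pdivrMr//; exact/ltW/truncnS_gt.
have FbigD (f : nat -> nat) P : F (\bigcup_(l in P) D (f l)).
  by apply: (@sigma_ring_bigcup P (D \o f)) => l; exact: FDn.
suff subseq (f : nat -> nat) : injective f ->
    (forall k, mu (f k) (\bigcup_l D (f l)) <= n%:R * e) ->
    exists2 f' : nat -> nat, injective f' &
      forall k, mu (f' k) (\bigcup_(l in [set~ k]) D (f' l)) <= e.
  by apply: (subseq id) => // k; apply: le_trans Cn; exact/muC/(FbigD id).
elim: n {Cn} f => [|n IH] f finj fn.
  exists f => // k; apply: le_trans (ltW e0); rewrite -[leRHS](mul0r e).
  apply: le_trans (fn k); apply: (le_content_on ringF (cmu _)) => //.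
  exact: bigcup_subset.
have tDf : trivIset setT (D \o f).
  by move=> k l _ _ Dkl; apply/finj/(tD _ _ I I).
have [[g ginj hg]|[g ginj hg]] :=
    @rosenthal_dichotomy (mu \o f) (D \o f) e (fun k => cmu _) (fun k => FDn _) tDf.
  by exists (f \o g) => //; exact: inj_comp.
apply: (IH (f \o g)); first exact: inj_comp.
move=> k; have := le_trans (hg k) (fn (g k)).
by rewrite -natr1 mulrDl mul1r lerD2r.
Qed.

End Rosenthal.

(* If disjoint sets [D k] carry mass of [mu (iota k)], then so does their union, up to the part
   outside [D k] and a null sequence. *)
Definition gliding_hump (mu : nat -> set U -> R) :=
  forall (D : nat -> set U) (iota : nat -> nat) (e : R),
  (forall k, F (D k)) -> trivIset setT D -> (forall k, e < mu (iota k) (D k)) ->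
  exists2 u : nat -> R, u @ \oo --> 0 &
    forall k, e <= u (iota k) + mu (iota k) (\bigcup_(l in [set~ k]) D l).

Variables (mu : nat -> set U -> R) (C : R).
Hypotheses (contmu : forall i, content_on F (mu i)) (mu_le : forall i A, F A -> mu i A <= C).

Lemma finitely_many_contents_exhaustive n (D : nat -> set U) (iota : nat -> nat) (e : R) :
  0 < e -> (forall k, F (D k)) -> trivIset setT D -> (forall k, (iota k < n)%N) ->
  ~ forall k, e < mu (iota k) (D k).
Proof.
move=> e0 FDk tD iotan he.
have e_le k : e <= \sum_(i < n) mu i (D k).
  apply: (le_trans (ltW (he k))); rewrite (bigD1 (Ordinal (iotan k)))//= lerDl.
  by apply: sumr_ge0 => i _; exact: (contmu i).1.
have total_le m : m%:R * e <= n%:R * C.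
  apply: (@le_trans _ _ (\sum_(k < m) \sum_(i < n) mu i (D k))).
    by rewrite -[m in leLHS]card_ord mulr_natl -sumr_const; exact: ler_sum.
  rewrite exchange_big/= -[n in leRHS]card_ord mulr_natl -sumr_const.
  apply: ler_sum => i _; rewrite -(content_on_bigsetU ringF (contmu i))//.
  by apply: mu_le; exact: (setring_bigsetU ringF).
have := total_le (Num.truncn (n%:R * C / e)).+1.
by rewrite -ler_pdivlMr// leNgt truncnS_gt.
Qed.

Hypothesis humpmu : gliding_hump mu.

Lemma uniformly_exhaustive (D : nat -> set U) (iota : nat -> nat) (e : R) :
  0 < e -> (forall k, F (D k)) -> trivIset setT D -> ~ forall k, e < mu (iota k) (D k).
Proof.
move=> e0 FDk tD he; have e20 : 0 < e / 2 by rewrite divr_gt0.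
have [f finj hf] :=
  rosenthal (fun k => contmu (iota k)) (fun k => @mu_le (iota k)) FDk tD e20.
have tDf : trivIset setT (D \o f).
  by move=> k l _ _ Dkl; apply/finj/(tD _ _ I I).
have [u u0 hu] :=
  @humpmu (D \o f) (iota \o f) e (fun k => FDk _) tDf (fun k => he (f k)).
have [n _ hn] : \forall i \near \oo, u i < e / 2.
  by move/cvgrPdist_lt : u0 => /(_ _ e20); apply: filterS => i;
    rewrite sub0r normrN => /ltr_normlW.
apply: (@finitely_many_contents_exhaustive n (D \o f) (iota \o f) e) => //= k.
rewrite ltnNge; apply/negP => /hn /=; apply/negP; rewrite -leNgt.
by have := hu k; have := hf k => /=; lra.
Qed.

Lemma increasing_uniform_cauchy (G : nat -> set U) (e : R) :
  0 < e -> (forall n, F (G n)) -> {homo G : m n / (m <= n)%N >-> m `<=` n} ->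
  exists m, forall n i, (m <= n)%N -> mu i (G n `\` G m) <= e.
Proof.
move=> e0 FG Gnd; apply: contrapT => notcauchy.
have /choice[next hnext] m : exists ni, (m <= ni.1)%N /\ e < mu ni.2 (G ni.1 `\` G m).
  apply: contrapT => h; apply: notcauchy; exists m => n i mn.
  by rewrite leNgt; apply/negP => ?; apply: h; exists (n, i).
pose m k := iter k (fun m => (next m).1) 0%N.
have m_nd : {homo m : k l / (k <= l)%N}.
  by apply: homo_leq => [|? ? ?|k]; [|exact: leq_trans|exact: (hnext (m k)).1].
apply: (@uniformly_exhaustive (fun k => G (m k.+1) `\` G (m k))
  (fun k => (next (m k)).2) e) => //.
- by move=> k; exact: FD.
- apply: ltn_trivIset => l k lk; rewrite -subset0 => x [[Gl _] [_ Gk]].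
  by apply: Gk; apply: Gnd Gl; exact: m_nd.
- by move=> k; exact: (hnext (m k)).2.
Qed.

Lemma decreasing_uniform_cauchy (G : nat -> set U) (e : R) :
  0 < e -> (forall n, F (G n)) -> {homo G : m n / (m <= n)%N >-> n `<=` m} ->
  exists m, forall n i, (m <= n)%N -> mu i (G m `\` G n) <= e.
Proof.
move=> e0 FG Gni.
have [||m hm] := @increasing_uniform_cauchy (fun n => G 0%N `\` G n) _ e0.
- by move=> n; exact: FD.
- by move=> n m nm x [G0 Gn]; split => // /(Gni _ _ nm).
exists m => n i mn; apply: le_trans (hm n i mn).
apply: (le_content_on ringF (contmu i)); [exact: FD|by apply: FD; exact: FD|].
move=> x [Gm Gn]; split; first by split=> //; apply: Gni Gm.
by move=> [_]; apply.
Qed.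

Lemma tail_hull (A : nat -> set U) (d : nat -> R) :
  (forall k, F (A k)) -> (forall k, 0 < d k) ->
  (forall k i, (i <= k)%N -> mu i (A k) <= 2 ^- k) ->
  exists H : nat -> set U, [/\ forall k, F (H k),
    forall k l i, (k <= l)%N -> mu i (A l `\` H k) <= d k &
    forall k i, (i <= k)%N -> mu i (H k) <= 2 * 2 ^- k].
Proof.
move=> FA d0 small; pose G k n := \big[setU/set0]_(j < n) A (k + j)%N.
have FG k n : F (G k n) by exact: (setring_bigsetU ringF n (fun j => FA (k + j)%N)).
have Gnd k : {homo G k : m n / (m <= n)%N >-> m `<=` n}.
  move=> m n mn x; rewrite /G -!(bigcup_mkord _ (fun j => A (k + j)%N)) => -[j /= jm Aj].
  by exists j => //=; exact: leq_trans mn.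
have /choice[n hn] k := increasing_uniform_cauchy (d0 k) (FG k) (Gnd k).
exists (fun k => G k (n k)); split => // [k l i kl|k i ik].
  pose p := maxn (n k) (l - k).+1; apply: le_trans (hn k p i (leq_maxl _ _)).
  apply: (le_content_on ringF (contmu i) (FD (FA l) (FG k (n k))) (FD (FG k p) (FG k (n k)))).
  apply: setSD => x Al; rewrite /G -(bigcup_mkord _ (fun j => A (k + j)%N)).
  by exists (l - k)%N; [rewrite /= leq_max leqnn orbT|rewrite subnKC].
apply: (le_trans (content_on_bigsetU_le ringF (contmu i) (n k) (fun j => FA (k + j)%N))).
apply: (@le_trans _ _ (\sum_(j < n k) 2 ^- k * 2 ^- j)).
  apply: ler_sum => j _; rewrite -invfM -exprD; apply: small.
  exact: leq_trans (leq_addr _ _).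
by rewrite -mulr_sumr mulrC ler_wpM2r ?sum_invr_expr2_le// invr_ge0 exprn_ge0.
Qed.

(* The finite intersections of the hulls [H l] of the tails decrease and keep half of the mass of
   [A k]; the contents being uniformly Cauchy along them, a single content keeps a quarter of it
   for all large [k], although it is small on [H k]. *)
Lemma uniform_absolute_continuity (A : nat -> set U) (e : R) :
  0 < e -> (forall k, F (A k)) ->
  (forall k i, (i <= k)%N -> mu i (A k) <= 2 ^- k) ->
  ~ forall k, exists i, e <= mu i (A k).
Proof.
move=> e0 FA small big; pose d k : R := e / 4 * 2 ^- k.
have d0 k : 0 < d k by rewrite mulr_gt0 ?divr_gt0// invr_gt0 exprn_gt0.
have [H [FH AH Hsmall]] := tail_hull FA d0 small.
pose K k := \bigcap_(l < k.+1) H l.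
have FK k : F (K k).
  have FI : setI_closed F by have /setD_closedP[] := FD.
  by apply: (finN0_bigcap_closedP F).1 => //; exists 0%N.
have K_ni : {homo K : k l / (k <= l)%N >-> l `<=` k}.
  by move=> k l kl x Kx j /= /leq_trans jk; apply: Kx; exact: jk.
have AK_le i k : mu i (A k `\` K k) <= e / 2.
  have -> : A k `\` K k = \big[setU/set0]_(l < k.+1) (A k `\` H l).
    rewrite -(bigcup_mkord _ (fun l => A k `\` H l)) /K; apply/seteqP; split => x.
      by move=> [Ax /existsNP[l /not_implyP[/= lk Hx]]]; exists l.
    by move=> [l lk [Ax Hx]]; split => // /(_ l lk).
  apply: (le_trans (content_on_bigsetU_le ringF (contmu i) k.+1 (fun l => FD (FA k) (FH l)))).
  apply: (@le_trans _ _ (\sum_(l < k.+1) d l)).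
    by apply: ler_sum => l _; apply: AH; rewrite -ltnS.
  rewrite -mulr_sumr; have := sum_invr_expr2_le R k.+1; nra.
have Kbig k : exists i, e / 2 <= mu i (K k).
  have [i hi] := big k; exists i.
  by have := content_on_le_setD ringF (contmu i) (FA k) (FK k); have := AK_le i k; lra.
have [k0 hk0] := decreasing_uniform_cauchy (divr_gt0 e0 (ltr0n R 4)) FK K_ni.
have [i hi] := Kbig k0; have [m hm] := invr_expr2_lt (divr_gt0 e0 (ltr0n R 8)).
pose k := (k0 + i + m)%N.
have k0k : (k0 <= k)%N by rewrite /k -addnA leq_addr.
have ik : (i <= k)%N by rewrite /k addnAC leq_addl.
have mk : 2 ^- k <= 2 ^- m :> R.
  by rewrite lef_pV2 ?posrE ?exprn_gt0// ler_weXn2l ?ler1n// leq_addl.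
have KH : mu i (K k) <= mu i (H k).
  by apply: (le_content_on ringF (contmu i)) => // x; apply => /=.
have := hk0 k i k0k; have := content_on_le_setD ringF (contmu i) (FK k0) (FK k).
by have := Hsmall k i ik; lra.
Qed.

End VitaliHahnSaks.

(** * Moduli of functionals *)

Lemma scale_mulfct (R : realType) (U : Type) (a : R) (f g : U -> R) :
  (a *: f) * g = a *: (f * g).
Proof. by apply/funext => u; rewrite !fctE /GRing.scale/= mulrA. Qed.

Lemma indicDU (R : pzRingType) (U : Type) (A B : set U) : A `&` B = set0 ->
  \1_(A `|` B) = \1_A + \1_B :> (U -> R).
Proof.
move=> AB0; apply/funext => u; rewrite fctE !indicE in_setU.
have : ~ (A `&` B) u by rewrite AB0.
case: (boolP (u \in A)) => [/set_mem Au|_]; case: (boolP (u \in B)) => [/set_mem Bu|_] //= nAB.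
- by have := nAB (conj Au Bu).
- by rewrite addr0.
- by rewrite add0r.
- by rewrite addr0.
Qed.

Lemma indic_comp (R : pzRingType) (U V : Type) (f : U -> V) (A : set V) :
  \1_(f @^-1` A) = \1_A \o f :> (U -> R).
Proof. by apply/funext. Qed.

Lemma indic_le1 (R : numDomainType) (U : Type) (A : set U) u : \1_A u <= 1 :> R.
Proof. by rewrite indicE lern1 leq_b1. Qed.

Section Glue.
Variables (R : pzRingType) (U : Type).
Implicit Types (D : nat -> set U) (z : nat -> U -> R).

Definition glue_seq D z : U -> R :=
  fun u => \1_(\bigcup_k D k) u * z (xget 0%N [set k | D k u]) u.

Lemma glue_seqE D z k u : trivIset setT D -> D k u -> glue_seq D z u = z k u.
Proof.
move=> tD Du; have DU : (\bigcup_k D k) u by exists k.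
rewrite /glue_seq indicE mem_set// mul1r; case: xgetP => [l _ Dl|/(_ k)//].
by congr (z _ _); apply: (tD _ _ I I); exists u.
Qed.

Lemma glue_seq0 D z u : ~ (\bigcup_k D k) u -> glue_seq D z u = 0.
Proof. by move=> nDu; rewrite /glue_seq indicE memNset// mul0r. Qed.

Lemma indic_bigcup_glue_seq D z k : trivIset setT D ->
  \1_(\bigcup_l D l) * glue_seq D z =
  \1_(D k) * z k + \1_(\bigcup_(l in [set~ k]) D l) * glue_seq D z.
Proof.
move=> tD; apply/funext => u; rewrite !fctE !indicE.
have [Du|nDu] := pselect (D k u).
  have DU : (\bigcup_l D l) u by exists k.
  rewrite (mem_set Du) (mem_set DU) (glue_seqE z tD Du) [in X in _ + X]memNset ?mul0r ?addr0//.
  by move=> [l /= lk Dl]; apply/lk/(tD _ _ I I); exists u.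
rewrite (memNset nDu) mul0r add0r; congr ((nat_of_bool _)%:R * _).
apply/idP/idP => /set_mem[l _ Dl]; apply/mem_set; exists l => //=.
by move=> lk; apply: nDu; rewrite -lk.
Qed.

End Glue.

Section Modulus.
Variables (R : realType) (U : Type).
Implicit Types (m y : U -> R) (M W Y : set (U -> R)) (phi : (U -> R) -> R).

Definition modulus W phi m : R := sup [set phi (m * y) | y in W].

(* Nonnegative multipliers [M] and a symmetric, [M]-convex set [W] of test functions: this is what
   makes [modulus] an additive function of the multiplier. *)
Record modulus_data M W Y phi : Prop := ModulusData {
  multiplierD : forall m m', M m -> M m' -> M (m + m');
  multiplierB : forall m m', M m -> M m' -> (forall u, m u <= m' u) -> M (m' - m);
  multiplierZ : forall c m, 0 <= c -> M m -> M (c *: m);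
  test0 : W 0;
  testN : forall y, W y -> W (- y);
  test_convex : forall m m' y y', M m -> M m' -> W y -> W y' ->
    exists2 w, W w & m * y + m' * y' = (m + m') * w;
  multiplier_test : forall m y, M m -> W y -> Y (m * y);
  functional_subspace : linear_subspace Y;
  functional_linear : linear_on Y phi;
  functional_bounded : forall m, M m -> has_ubound [set phi (m * y) | y in W] }.

Variables (M W Y : set (U -> R)) (phi : (U -> R) -> R).
Hypothesis md : modulus_data M W Y phi.
Let subY := functional_subspace md.
Let phi_lin := functional_linear md.
Let Ymul := multiplier_test md.
Local Notation rho := (modulus W phi).

Lemma le_functional_modulus m y : M m -> W y -> phi (m * y) <= rho m.
Proof. by move=> Mm Wy; apply: ub_le_sup; [exact: (functional_bounded md Mm)|exists y]. Qed.

Lemma modulus_le_ub m c : (forall y, W y -> phi (m * y) <= c) -> rho m <= c.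
Proof.
move=> phic; apply: ge_sup; last by move=> _ [y Wy <-]; exact: phic.
by exists (phi (m * 0)); exists 0 => //; exact: (test0 md).
Qed.

Lemma norm_functional_le_modulus m y : M m -> W y -> `|phi (m * y)| <= rho m.
Proof.
move=> Mm Wy; rewrite ler_norml le_functional_modulus// andbT lerNl.
rewrite -(linear_onN subY phi_lin); last exact: Ymul.
by rewrite -mulrN; apply: le_functional_modulus => //; exact: (testN md Wy).
Qed.

Lemma modulus_ge0 m : M m -> 0 <= rho m.
Proof.
by move=> Mm; exact: le_trans (normr_ge0 _) (norm_functional_le_modulus Mm (test0 md)).
Qed.

Lemma modulusD m m' : M m -> M m' -> rho (m + m') = rho m + rho m'.
Proof.
move=> Mm Mm'; apply/eqP; rewrite eq_le; apply/andP; split.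
  apply: modulus_le_ub => y Wy.
  rewrite mulrDl (linear_onD phi_lin); [|exact: Ymul|exact: Ymul].
  by rewrite lerD// le_functional_modulus.
rewrite -lerBrDl; apply: modulus_le_ub => y' Wy'.
rewrite lerBrDl -lerBrDr; apply: modulus_le_ub => y Wy.
rewrite lerBrDr -(linear_onD phi_lin); [|exact: Ymul|exact: Ymul].
have [w Ww ->] := test_convex md Mm Mm' Wy Wy'.
by apply: le_functional_modulus => //; exact: (multiplierD md Mm Mm').
Qed.

Lemma le_modulus m m' : M m -> M m' -> (forall u, m u <= m' u) -> rho m <= rho m'.
Proof.
move=> Mm Mm' mm'; have MB := multiplierB md Mm Mm' mm'.
by rewrite -[m'](subrKC m) modulusD// lerDl modulus_ge0.
Qed.

Lemma modulusZ c m : 0 < c -> M m -> rho (c *: m) = c * rho m.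
Proof.
have leZ (b : R) m' : 0 < b -> M m' -> rho (b *: m') <= b * rho m'.
  move=> b0 Mm'; apply: modulus_le_ub => y Wy.
  rewrite scale_mulfct (linear_onZ subY phi_lin); last exact: Ymul.
  by rewrite ler_wpM2l ?le_functional_modulus// ltW.
move=> c0 Mm; apply/eqP; rewrite eq_le leZ//= -ler_pdivlMl//.
rewrite -{1}[m](scalerK (lt0r_neq0 c0)); apply: leZ; first by rewrite invr_gt0.
exact: (multiplierZ md (ltW c0)).
Qed.

Lemma modulus_parallelogram m1 m2 m3 m4 : M m1 -> M m2 -> M m3 -> M m4 ->
  4 *: m1 + m2 = 2 *: m3 + 2 *: m4 ->
  4 * rho m1 + rho m2 = 2 * rho m3 + 2 * rho m4.
Proof.
move=> M1 M2 M3 M4 parallelogram; have MZ := multiplierZ md.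
by rewrite -!modulusZ// -!modulusD ?parallelogram//; exact: MZ.
Qed.

Lemma modulus_markov c (A : set U) m : 0 < c -> M \1_A -> M m -> (forall u, 0 <= m u) ->
  (forall u, A u -> c <= m u) -> c * rho \1_A <= rho m.
Proof.
move=> c0 MA Mm m0 Am; rewrite -modulusZ//; apply: le_modulus => //.
  exact: (multiplierZ md (ltW c0)).
move=> u; rewrite fctE indicE /GRing.scale/=.
by have [/set_mem/Am|_] := boolP (u \in A); rewrite ?mulr1// mulr0.
Qed.

Variable F : set (set U).
Hypothesis F_indic : forall A, F A -> M \1_A.

Lemma modulus_content : content_on F (fun A => rho \1_A).
Proof.
split=> [A FA|A B FA FB AB0]; first exact/modulus_ge0/F_indic.
by rewrite indicDU// modulusD//; exact: F_indic.
Qed.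

End Modulus.

Section ModulusSequence.
Variables (R : realType) (U : Type) (M W Y : set (U -> R)) (phi : nat -> (U -> R) -> R).
Variables (F : set (set U)) (C : R).
Hypotheses (md : forall i, modulus_data M W Y (phi i)) (sigmaF : sigma_ring F)
  (F_indic : forall A, F A -> M \1_A)
  (W_glue_seq : forall D z, (forall k, F (D k)) -> trivIset setT D -> (forall k, W (z k)) ->
     W (glue_seq D z))
  (phi_cvg0 : forall A y, F A -> W y -> phi i (\1_A * y) @[i --> \oo] --> 0)
  (phi_le : forall i A y, F A -> W y -> phi i (\1_A * y) <= C).

Lemma modulus_gliding_hump : gliding_hump F (fun i A => modulus W (phi i) \1_A).
Proof.
have Fbigcup := @sigma_ring_bigcup _ _ sigmaF.
move=> D iota e FD tD De.
have /choice[z hz] k : exists z, W z /\ e < phi (iota k) (\1_(D k) * z).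
  have /sup_gt[|_ [z Wz <-] ez] := De k; last by exists z.
  by exists (phi (iota k) (\1_(D k) * 0)); exists 0 => //; exact: (test0 (md 0%N)).
have Wy : W (glue_seq D z) by apply: W_glue_seq => // k; exact: (hz k).1.
exists (fun i => phi i (\1_(\bigcup_k D k) * glue_seq D z)).
  by apply: phi_cvg0 => //; exact: Fbigcup.
move=> k; rewrite (indic_bigcup_glue_seq z k tD); set E := \bigcup_(l in _) _.
have FE : F E by exact: Fbigcup.
have Ymul A w : F A -> W w -> Y (\1_A * w).
  by move=> /F_indic MA Ww; exact: (multiplier_test (md 0%N) MA Ww).
have Yz : Y (\1_(D k) * z k) by apply: Ymul => //; exact: (hz k).1.
rewrite (linear_onD (functional_linear (md _)))//; last exact: Ymul.
rewrite -addrA; apply: (le_trans (ltW (hz k).2)); rewrite lerDl -lerBlDr sub0r lerNl.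
have := norm_functional_le_modulus (md (iota k)) (F_indic FE) Wy.
by rewrite ler_norml lerNl => /andP[].
Qed.

Lemma modulus_uniform_absolute_continuity (A : nat -> set U) (e : R) :
  0 < e -> (forall k, F (A k)) ->
  (forall k i, (i <= k)%N -> modulus W (phi i) \1_(A k) <= 2 ^- k) ->
  ~ forall k, exists i, e <= modulus W (phi i) \1_(A k).
Proof.
apply: (@uniform_absolute_continuity _ _ _ sigmaF (fun i A => modulus W (phi i) \1_A) C).
- by move=> i; exact: (modulus_content (md i) F_indic).
- by move=> i B FB; apply: (modulus_le_ub (md i)) => y; exact: phi_le.
- exact: modulus_gliding_hump.
Qed.

End ModulusSequence.

(** * Convex approximation *)

Section ConvexApproximation.
Variable R : realType.

Definition convex_in (V : lmodType R) (S : set V) := forall (t : R) v w,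
  0 <= t <= 1 -> S v -> S w -> S ((1 - t) *: v + t *: w).

(* By the parallelogram law, two near-minimizers of [q] on a convex set are [q]-close. *)
Lemma decreasing_convex_near (V : lmodType R) (q : V -> R) (S : nat -> set V) (C e : R) :
  (forall v, S 0%N v -> 0 <= q v <= C) ->
  {homo S : m n / (m <= n)%N >-> n `<=` m} ->
  (forall n, S n !=set0) -> (forall n, convex_in (S n)) ->
  (forall v w, S 0%N v -> S 0%N w ->
     4 * q (2^-1 *: (v + w)) + q (v - w) = 2 * q v + 2 * q w) ->
  0 < e -> exists m v, S m v /\
    forall n, (m <= n)%N -> exists2 w, S n w & q (w - v) <= e.
Proof.
move=> qC S_ni S0 Sconv qpar e0; pose d n := inf (q @` S n).
have S0S n v : S n v -> S 0%N v by exact: S_ni.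
have lbq n : has_lbound (q @` S n).
  by exists 0 => _ [v /S0S/qC/andP[q0 _] <-].
have dq n v : S n v -> d n <= q v by move=> Sv; apply: ge_inf => //; exists v.
have e80 : 0 < e / 8 by rewrite divr_gt0.
have near_min n : exists2 v, S n v & q v < d n + e / 8.
  have [|_ [v Sv <-] qv] := inf_adherent e80 (_ : has_inf (q @` S n)); last by exists v.
  by split => //; have [v Sv] := S0 n; exists (q v), v.
have supd : has_sup (range d).
  split; first by exists (d 0%N), 0%N.
  exists C => _ [n _ <-]; have [v Sv] := S0 n.
  by apply: (le_trans (dq _ _ Sv)); have /S0S/qC/andP[] := Sv.
have [_ [m _ <-] dm] := sup_adherent e80 supd.
have [v Sv qv] := near_min m; exists m, v; split => // n mn.
have [w Sw qw] := near_min n; exists w => //.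
have Svw : S m (2^-1 *: (w + v)).
  have -> : 2^-1 *: (w + v) = (1 - 2^-1) *: w + 2^-1 *: v.
    by rewrite scalerDr; congr (_ *: _ + _); field.
  by apply: Sconv (S_ni _ _ mn _ Sw) Sv; lra.
have dn : d n <= sup (range d) by apply: ub_le_sup; [exact: supd.2|exists n].
by have := qpar _ _ (S0S _ _ Sw) (S0S _ _ Sv); have := dq _ _ Svw; lra.
Qed.

Section Helly.
Variable I : finType.
Implicit Types (s u v : I -> R) (S : set (I -> R)).

Definition sqdist v s : R := \sum_i (v i - s i) ^+ 2.

Lemma sqdist_segment v s s' (t : R) :
  sqdist v ((1 - t) *: s + t *: s') = sqdist v s
    - 2 * t * \sum_i (v i - s i) * (s' i - s i) + t ^+ 2 * sqdist s' s.
Proof.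
rewrite /sqdist !mulr_sumr -sumrB -big_split/=; apply: eq_bigr => i _.
by rewrite !fctE /GRing.scale/=; ring.
Qed.

(* A point dominated by the support function of a convex set lies in its closure: otherwise moving
   a near-closest point towards a point that is extremal in the direction of [v] gets closer. *)
Lemma support_le_closure S v (D e : R) : S !=set0 ->
  (forall s s', S s -> S s' -> sqdist s' s <= D) -> convex_in S ->
  (forall u d, 0 < d -> exists2 s, S s & \sum_i u i * v i <= \sum_i u i * s i + d) ->
  0 < e -> exists2 s, S s & sqdist v s < e.
Proof.
move=> [s0 Ss0] SD Sconv Ssup e0; apply: contrapT => far.
have dist_ge s : S s -> e <= sqdist v s.
  by move=> Ss; rewrite leNgt; apply/negP => ?; apply: far; exists s.
have D0 : 0 <= D by apply: le_trans (SD _ _ Ss0 Ss0); apply: sumr_ge0 => i _; rewrite sqr_ge0.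
have De : 0 < 2 * D + e by lra.
pose t := e / (2 * D + e); have t0 : 0 < t by rewrite divr_gt0.
have t1 : t <= 1 by rewrite ler_pdivrMr// mul1r; lra.
have tD : t * D <= e / 2 by rewrite /t mulrAC ler_pdivrMr//; nra.
have lbdist : has_lbound (sqdist v @` S) by exists e => _ [s /dist_ge ? <-].
have te0 : 0 < t * e / 2 by rewrite divr_gt0// mulr_gt0.
have [|_ [s Ss <-] smin] := inf_adherent te0 (_ : has_inf (sqdist v @` S)).
  by split => //; exists (sqdist v s0), s0.
have [s' Ss' s'max] := Ssup (v - s) (e / 4) (divr_gt0 e0 (ltr0n _ 4)).
have slope_ge : 3 / 4 * e <= \sum_i (v i - s i) * (s' i - s i).
  have -> : \sum_i (v i - s i) * (s' i - s i) =
      \sum_i (v - s) i * s' i - \sum_i (v - s) i * v i + sqdist v s.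
    by rewrite -sumrB -big_split/=; apply: eq_bigr => i _; rewrite !fctE; ring.
  by have := dist_ge _ Ss; move: s'max; lra.
have : inf (sqdist v @` S) <= sqdist v ((1 - t) *: s + t *: s').
  apply: ge_inf => //; eexists; last reflexivity.
  by apply: Sconv => //; rewrite t1 ltW.
rewrite sqdist_segment; have := SD _ _ Ss Ss'; move: smin slope_ge.
set a := \sum_i _; set b := sqdist s' s; set m := inf _ => smin slope_ge bD.
have tb : t * (t * b) <= t * (e / 2).
  by rewrite ler_wpM2l ?(ltW t0)//; apply: le_trans tD; rewrite ler_wpM2l ?(ltW t0).
have ta : t * (3 / 4 * e) <= t * a by rewrite ler_wpM2l ?(ltW t0).
have -> : t ^+ 2 * b = t * (t * b) by ring.
have : 0 < t * e by rewrite mulr_gt0.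
lra.
Qed.

Lemma helly (V : lmodType R) (Y B : set V) (chi : I -> V -> R) v (C e : R) :
  B !=set0 -> convex_in B -> B `<=` Y -> linear_subspace Y ->
  (forall i, linear_on Y (chi i)) ->
  (exists D, forall i y, B y -> `|chi i y| <= D) ->
  0 < C -> (forall u M, (forall y, B y -> \sum_i u i * chi i y <= M) ->
    \sum_i u i * v i <= C * M) ->
  0 < e -> exists2 y, B y & forall i, `|v i - C * chi i y| < e.
Proof.
move=> [y0 By0] Bconv BY subY chilin [D chiD] C0 vC e0.
pose S := [set C *: chi^~ y | y in B].
have [||||s [y By <-] vs] := @support_le_closure S v (\sum_(i : I) (C * (2 * D)) ^+ 2) _ _ _ _ _
  (exprn_gt0 2 e0).
- by exists (C *: chi^~ y0), y0.
- move=> _ _ [y By <-] [z Bz <-]; apply: ler_sum => i _.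
  rewrite !fctE -[C *: _ - _]mulrBr !exprMn ler_wpM2l ?sqr_ge0//.
  rewrite -real_normK ?num_real// -[leRHS]exprMn ler_sqr ?nnegrE//; last first.
    by rewrite mulr_ge0// (le_trans _ (chiD i _ By)).
  rewrite mulr_natl mulr2n; apply: (le_trans (ler_normB _ _)).
  by apply: lerD; exact: chiD.
- move=> t _ _ t01 [y By <-] [z Bz <-]; exists ((1 - t) *: y + t *: z); first exact: Bconv.
  apply/funext => i; rewrite !fctE (linear_onD (chilin i)) ?(linear_onZ subY (chilin i)).
  + by rewrite /GRing.scale/=; ring.
  + exact: BY.
  + exact: BY.
  + by apply: linear_subspaceZ => //; exact: BY.
  + by apply: linear_subspaceZ => //; exact: BY.
- move=> u d d0; apply: contrapT => below.
  have : \sum_i u i * v i <= C * ((\sum_i u i * v i - d) / C).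
    apply: vC => y By; rewrite ler_pdivlMr// lerBrDr ltW// ltNge; apply/negP => h.
    apply: below; exists (C *: chi^~ y); first by exists y.
    apply: (le_trans h); rewrite lerD2r mulr_suml le_eqVlt; apply/orP; left; apply/eqP.
    by apply: eq_bigr => i _; rewrite !fctE /GRing.scale/=; ring.
  by rewrite mulrC divfK ?gt_eqF//; lra.
exists y => // i; rewrite -ltr_sqr ?nnegrE ?(ltW e0)// real_normK ?num_real//.
apply: le_lt_trans vs; rewrite /sqdist (bigD1 i)//= lerDl.
by apply: sumr_ge0 => j _; rewrite sqr_ge0.
Qed.

End Helly.
End ConvexApproximation.

(** * Uniform boundedness *)

Section UniformBoundedness.
Variables (R : realType) (V : lmodType R) (Y B : set V).
Hypotheses (subY : linear_subspace Y) (BY : B `<=` Y) (BN : forall y, B y -> B (- y)).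

Lemma signed_series (phi : nat -> V -> R) (z : nat -> V) :
  (forall k, linear_on Y (phi k)) -> (forall k, Y (z k)) ->
  exists w : nat -> V, forall k, (w k = z k \/ w k = - z k) /\
    `|phi k (z k)| <= `|phi k (\sum_(l < k.+1) w l)|.
Proof.
move=> phi_lin Yz.
pose step k x := if `|phi k (z k)| <= `|phi k (x + z k)| then z k else - z k.
pose X n := iteri n (fun k x => x + step k x) 0; pose w k := step k (X k).
have Yw k : Y (w k).
  by rewrite /w /step; case: ifP => // _; rewrite -scaleN1r; exact: linear_subspaceZ.
have XE n : X n = \sum_(l < n) w l.
  by elim: n => [|n IH]; [rewrite big_ord0|rewrite big_ord_recr/= -IH].
have YX n : Y (X n) by rewrite XE; exact: linear_subspace_sum.
exists w => k; split; first by rewrite /w /step; case: ifP; [left|right].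
rewrite -XE /= /step; case: ifPn => // /negbTE; rewrite leNgt => /negbFE.
rewrite (linear_onD (phi_lin k))// (linear_onB (phi_lin k))// => small.
have : 2 * `|phi k (z k)| <= `|phi k (X k) + phi k (z k)| + `|phi k (X k) - phi k (z k)|.
  rewrite -[2 in leLHS]normr_nat -normrM -[X in _ + X]normrN.
  apply: le_trans (ler_normD _ _); rewrite le_eqVlt; apply/orP; left; apply/eqP.
  by congr `|_|; ring.
lra.
Qed.

Lemma norm_functional_tail (phi : V -> R) (N rho : R) x X : linear_on Y phi ->
  (forall y, B y -> `|phi y| <= N) -> Y x -> Y X -> 0 < rho ->
  B ((3 / rho) *: (x - X)) -> 2 / 3 * rho * N <= `|phi X| -> rho * N / 3 <= `|phi x|.
Proof.
move=> phi_lin phiN Yx YX rho0 /phiN + phiX.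
have r0 : 0 < 3 / rho by rewrite divr_gt0.
rewrite (linear_onZ subY phi_lin); last exact: linear_subspaceB.
rewrite (linear_onB phi_lin)// normrM gtr0_norm// -ler_pdivlMl// invf_div => tail.
by have := lerB_normD (phi X) (phi x - phi X); rewrite subrKC; lra.
Qed.

Definition sup_norm (phi : V -> R) : R := sup [set `|phi y| | y in B].

Lemma le_sup_norm (phi : V -> R) y :
  (exists C, forall y, B y -> `|phi y| <= C) -> B y -> `|phi y| <= sup_norm phi.
Proof.
move=> [C phiC] By; apply: ub_le_sup; last by exists y.
by exists C => _ [z Bz <-]; exact: phiC.
Qed.

Lemma ex_almost_norming (phi : V -> R) y :
  (exists C, forall y, B y -> `|phi y| <= C) -> B y -> 0 < `|phi y| ->
  exists2 z, B z & 2 / 3 * sup_norm phi < `|phi z|.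
Proof.
move=> phi_bdd By phiy; have /sup_gt[|_ [z Bz <-] ?] : 2 / 3 * sup_norm phi < sup_norm phi.
- by have := lt_le_trans phiy (le_sup_norm phi_bdd By); lra.
- by exists (`|phi y|), y.
- by exists z.
Qed.

(* Summing badly behaved elements with rapidly decreasing weights, the sign of each term makes the
   partial sums as large as the new term, and the tail is too small to undo this. *)
Lemma sigma_convex_uniform_boundedness (phi : nat -> V -> R) : B !=set0 ->
  (forall y : nat -> V, (forall k, B (y k)) -> exists2 x, B x &
     forall n, B ((3 * 4 ^+ n) *: (x - \sum_(k < n) 4 ^- k.+1 *: y k))) ->
  (forall i, linear_on Y (phi i)) ->
  (forall i, exists C, forall y, B y -> `|phi i y| <= C) ->
  (forall y, B y -> exists C, forall i, `|phi i y| <= C) ->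
  exists2 C : R, 0 < C & forall i y, B y -> `|phi i y| <= C.
Proof.
move=> [y0 By0] sigmaB phi_lin phi_bdd phi_ptbdd; apply: contrapT => unbounded.
pose N i := sup_norm (phi i); pose rho k : R := 4 ^- k.+1.
have rho0 k : 0 < rho k by rewrite invr_gt0 exprn_gt0.
have /choice[f hf] (k : nat) : exists iy : nat * V,
    [/\ B iy.2, 2 / 3 * N iy.1 < `|phi iy.1 iy.2| & 3 * k%:R * 4 ^+ k.+1 < N iy.1].
  have pow_ge0 : 0 <= 3 * k%:R * 4 ^+ k.+1 :> R by rewrite !mulr_ge0// exprn_ge0.
  have [i [y By iy]] : exists i, exists2 y, B y & 3 * k%:R * 4 ^+ k.+1 < `|phi i y|.
    apply: contrapT => h; apply: unbounded; exists (3 * k%:R * 4 ^+ k.+1 + 1) => [|i y By].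
      by rewrite ltr_pwDr.
    by apply: ler_wpDr => //; rewrite leNgt; apply/negP => ?; apply: h; exists i, y.
  have [z Bz hz] := ex_almost_norming (phi_bdd i) By (le_lt_trans pow_ge0 iy).
  by exists (i, z); split => //; exact: lt_le_trans iy (le_sup_norm (phi_bdd i) By).
pose i k := (f k).1; pose y k := (f k).2.
have By k : B (y k) by have [] := hf k.
have Yry k : Y (rho k *: y k) by apply: linear_subspaceZ => //; exact: BY.
have [w hw] := signed_series (fun k => phi_lin (i k)) Yry.
have /choice[v vE] k : exists v, B v /\ rho k *: v = w k.
  have [[->|->] _] := hw k; first by exists (y k).
  by exists (- y k); rewrite scalerN; split => //; exact: BN.
have [x Bx tail] := sigmaB v (fun k => (vE k).1).
have [C phixC] := phi_ptbdd x Bx.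
have growth k : k%:R <= `|phi (i k) x|.
  have [_ yN Nk] := hf k; rewrite -/(i k) -/(y k) in yN Nk.
  have Yw l : Y (w l).
    by rewrite -(vE l).2; apply: linear_subspaceZ => //; apply: BY; exact: (vE l).1.
  pose X := \sum_(l < k.+1) w l.
  have BX : B ((3 / rho k) *: (x - X)).
    have := tail k.+1; rewrite /rho invrK (eq_bigr (w \o val)) => // l _.
    exact: (vE l).2.
  have YX : Y X by apply: (linear_subspace_sum subY) => l; exact: Yw.
  have X_large : 2 / 3 * rho k * N (i k) <= `|phi (i k) X|.
    apply: le_trans (hw k).2; rewrite (linear_onZ subY (phi_lin _)); last exact: BY.
    by rewrite normrM gtr0_norm// [2 / 3 * _]mulrC -mulrA ler_wpM2l ?ltW.
  have x_large := norm_functional_tail (phi_lin (i k)) (fun _ => le_sup_norm (phi_bdd (i k)))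
    (BY Bx) YX (rho0 k) BX X_large.
  apply: le_trans x_large; rewrite ler_pdivlMr// /rho [leRHS]mulrC ler_pdivlMr ?exprn_gt0//.
  by move: Nk; rewrite -/(N _); lra.
by have := le_trans (growth (Num.truncn C).+1) (phixC _); rewrite leNgt truncnS_gt.
Qed.

End UniformBoundedness.

(** * Balls over a family of scales *)

Lemma measurable_norm_EFin d (T : measurableType d) (R : realType) (D : set T) (f : T -> R) :
  measurable_fun D f -> measurable_fun D (fun x => `|f x|%:E).
Proof. by move=> mf; apply/measurable_EFinP; exact: measurableT_comp. Qed.

Lemma measurable_norm_gt d (T : measurableType d) (R : realType) (f : T -> R) (a : R) :
  measurable_fun setT f -> measurable [set x | a < `|f x|].
Proof.
move=> mf; have mlt : measurable_fun setT (fun x => a < `|f x|).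
  by apply: measurable_fun_ltr => //; exact: measurableT_comp.
by have := mlt measurableT [set true] I; rewrite setTI preimage_true.
Qed.

Section ScaledBall.
Context {R : realType} {d : measure_display} {T : measurableType d}.
Variables (mu : {measure set T -> \bar R}) (I : Type) (tau : I -> \bar R).
Hypothesis tau_ge0 : forall j, (0 <= tau j)%E.
Implicit Types (y z : I * T -> R) (c : R).

Definition slice_measurable y := forall j, measurable_fun setT (fun x => y (j, x)).

Definition scaled_ball c : set (I * T -> R) := [set y : I * T -> R | forall j,
  [/\ measurable_fun setT (fun x => y (j, x)), forall x, `|y (j, x)| <= c &
      (\int[mu]_x `|y (j, x)|%:E <= c%:E * tau j)%E]].

Definition scaled_space : set (I * T -> R) :=
  [set y : I * T -> R | exists2 c, 0 < c & scaled_ball c y].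

Local Notation B := scaled_ball.
Local Notation Y := scaled_space.

Lemma slice_measurableM y z : slice_measurable y -> slice_measurable z ->
  slice_measurable (y * z).
Proof. by move=> my mz j; exact: measurable_funM. Qed.

Lemma slice_measurableB y z : slice_measurable y -> slice_measurable z ->
  slice_measurable (y - z).
Proof. by move=> my mz j; exact: measurable_funB. Qed.

Lemma slice_measurable_indic (D : set (I * T)) :
  (forall j, measurable [set x | D (j, x)]) -> slice_measurable \1_D.
Proof.
move=> mD j; rewrite (_ : (fun x => _) = \1_[set x | D (j, x)]); first exact: measurable_indic.
by rewrite -[RHS](indic_comp _ (pair j)).
Qed.

Lemma slice_measurable_comp_fst (a : I -> R) : slice_measurable (a \o fst).
Proof. by move=> j; exact: (measurable_cst (a j)). Qed.

Lemma scaled_ball_measurable c y : B c y -> slice_measurable y.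
Proof. by move=> By j; have [] := By j. Qed.

Lemma scaled_ball_norm_le c y u : B c y -> `|y u| <= c.
Proof. by case: u => j x By; have [] := By j. Qed.

Lemma scaled_ball_integral_le c y j : B c y ->
  (\int[mu]_x `|y (j, x)|%:E <= c%:E * tau j)%E.
Proof. by move=> By; have [] := By j. Qed.

Lemma scaled_ball_dom c y z : B c y -> slice_measurable z ->
  (forall u, `|z u| <= `|y u|) -> B c z.
Proof.
move=> By mz zy j; have [my yc iy] := By j; split => //.
  by move=> x; exact: le_trans (zy _) (yc x).
apply: le_trans iy; apply: ge0_le_integral => //; try exact: measurable_norm_EFin.
by move=> x _; rewrite lee_fin.
Qed.

Lemma scaled_ball_mul c y z : B c y -> slice_measurable z -> (forall u, `|z u| <= 1) ->
  B c (y * z).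
Proof.
move=> By mz z1; apply: (scaled_ball_dom By).
  by apply: slice_measurableM => //; exact: (scaled_ball_measurable By).
by move=> u; rewrite fctE normrM ler_piMr.
Qed.

Lemma scaled_ball_le c c' y : 0 <= c -> c <= c' -> B c y -> B c' y.
Proof.
move=> c0 cc By j; have [my yc iy] := By j; split => //.
  by move=> x; exact: le_trans (yc x) cc.
by apply: (le_trans iy); apply: lee_wpmul2r => //; rewrite lee_fin.
Qed.

Lemma scaled_ball0 c : 0 <= c -> B c 0.
Proof.
move=> c0 j; split => [|x|]; first exact: measurable_cst.
  by rewrite normr0.
by under eq_integral do rewrite normr0; rewrite integral0 mule_ge0// lee_fin.
Qed.

Lemma scaled_ballD c c' y y' : 0 <= c -> 0 <= c' -> B c y -> B c' y' -> B (c + c') (y + y').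
Proof.
move=> c0 c'0 By By' j; have [my yc iy] := By j; have [my' yc' iy'] := By' j; split.
- exact: measurable_funD.
- by move=> x; apply: (le_trans (ler_normD _ _)); exact: lerD.
- apply: (@le_trans _ _ (\int[mu]_x (`|y (j, x)|%:E + `|y' (j, x)|%:E))%E).
    apply: ge0_le_integral => //.
    + by apply: measurable_norm_EFin; exact: measurable_funD.
    + by apply: emeasurable_funD; exact: measurable_norm_EFin.
    + by move=> x _; rewrite -EFinD lee_fin; exact: ler_normD.
  rewrite ge0_integralD//; try exact: measurable_norm_EFin.
  by rewrite EFinD ge0_muleDl// ?lee_fin//; exact: leeD.
Qed.

Lemma scaled_ballZ c a y : B c y -> B (`|a| * c) (a *: y).
Proof.
move=> By j; have [my yc iy] := By j; split.
- exact: measurable_funM.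
- by move=> x; rewrite fctE normrM ler_wpM2l.
- under eq_integral do rewrite fctE normrM EFinM.
  rewrite ge0_integralZl//; last exact: measurable_norm_EFin.
  by rewrite EFinM -muleA; apply: lee_wpmul2l.
Qed.

Lemma scaled_ballN c y : B c y -> B c (- y).
Proof. by move=> /(scaled_ballZ (-1)); rewrite normrN normr1 mul1r scaleN1r. Qed.

Lemma scaled_ball_sum (c : nat -> R) (y : nat -> I * T -> R) n :
  (forall k, 0 <= c k) -> (forall k, B (c k) (y k)) ->
  B (\sum_(k < n) c k) (\sum_(k < n) y k).
Proof.
move=> c0 By; elim: n => [|n IH]; first by rewrite !big_ord0; exact: scaled_ball0.
by rewrite !big_ord_recr; apply: scaled_ballD => //; exact: sumr_ge0.
Qed.

Lemma scaled_ball_convex c : 0 <= c -> convex_in (B c).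
Proof.
move=> c0 t y y' /andP[t0 t1] By By'; have t10 : 0 <= 1 - t by rewrite subr_ge0.
have -> : c = `|1 - t| * c + `|t| * c by rewrite !ger0_norm//; ring.
by apply: scaled_ballD; [exact: mulr_ge0|exact: mulr_ge0|exact: scaled_ballZ|exact: scaled_ballZ].
Qed.

Lemma scaled_ball_slices c y :
  (forall j, exists2 z, B c z & forall x, y (j, x) = z (j, x)) -> B c y.
Proof.
move=> h j; have [z Bz yz] := h j.
by have := Bz j; under eq_fun do rewrite -yz; under eq_integral do rewrite -yz;
  move=> [? zc ?]; split => // x; rewrite yz.
Qed.

Lemma scaled_ball_scale c (a : I -> R) y : 0 <= c -> (forall j, `|a j| <= c) -> B 1 y ->
  B c ((a \o fst) * y).
Proof.
move=> c0 ac By; apply: scaled_ball_slices => j; exists (a j *: y) => //.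
by have := scaled_ballZ (a j) By; rewrite mulr1; exact: scaled_ball_le.
Qed.

Lemma scaled_ball_indic (E : set (I * T)) :
  (forall j, measurable [set x | E (j, x)]) ->
  (forall j, (mu [set x | E (j, x)] <= tau j)%E) -> B 1 \1_E.
Proof.
move=> mE Etau j; have indE x : \1_E (j, x) = \1_[set x | E (j, x)] x :> R.
  by rewrite -[LHS]/((\1_E \o pair j) x) -indic_comp.
split; first exact: slice_measurable_indic.
- by move=> x; rewrite ger0_norm ?indic_le1// indicE.
- under eq_integral do rewrite indE ger0_norm ?indicE//.
  by rewrite mul1e integral_indic// setIT.
Qed.

Lemma scaled_ball_lim c (y : nat -> I * T -> R) z : (forall n, B c (y n)) ->
  (forall u, y n u @[n --> \oo] --> z u) -> B c z.
Proof.
move=> By yz j; have nyz u : `|y n u| @[n --> \oo] --> `|z u| by exact: cvg_norm.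
split.
- apply: (@measurable_fun_cvg _ _ _ setT (fun n x => y n (j, x))) => [n|x _]; last exact: yz.
  exact: (scaled_ball_measurable (By n) j).
- move=> x; apply: (@cvgr_to_le _ _ _ _ (fun n => `|y n (j, x)|) _ _ (nyz _)).
  by apply: nearW => n; exact: scaled_ball_norm_le.
rewrite (eq_integral (fun x => limn_einf (fun n => `|y n (j, x)|%:E))); last first.
  move=> x _; apply/esym; apply: (cvg_limn_einf_sup _).1.
  by apply: cvg_EFin; [exact: nearW|exact: nyz].
apply: le_trans (fatou _ _ _ _) _ => // [n|].
  by apply: measurable_norm_EFin; exact: (scaled_ball_measurable (By n) j).
rewrite limn_einf_lim; apply: lime_le; first exact: is_cvg_einfs.
apply: nearW => n; apply: (@le_trans _ _ (\int[mu]_x `|y n (j, x)|%:E)%E).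
  by apply: ereal_inf_lbound; exists n => /=.
exact: scaled_ball_integral_le.
Qed.

Lemma scaled_ball_space c y : 0 <= c -> B c y -> Y y.
Proof.
move=> c0 By; exists (c + 1); first by rewrite ltr_pwDr.
by apply: scaled_ball_le By => //; rewrite lerDl.
Qed.

Lemma scaled_space_measurable y : Y y -> slice_measurable y.
Proof. by move=> [c _]; exact: scaled_ball_measurable. Qed.

Lemma scaled_space_subspace : linear_subspace Y.
Proof.
split; first by apply: (@scaled_ball_space 1) => //; exact: scaled_ball0.
move=> a y z [c /ltW c0 By] [c' /ltW c'0 Bz]; have ac0 : 0 <= `|a| * c by exact: mulr_ge0.
apply: (@scaled_ball_space (`|a| * c + c')); first exact: addr_ge0.
by apply: scaled_ballD => //; exact: scaled_ballZ.
Qed.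

Lemma scaled_ball_functional_le (phi : (I * T -> R) -> R) C c y : linear_on Y phi ->
  (forall y, B 1 y -> `|phi y| <= C) -> 0 < c -> B c y -> `|phi y| <= c * C.
Proof.
move=> phi_lin phiC c0 By; have /phiC : B 1 (c^-1 *: y).
  have -> : 1 = `|c^-1| * c by rewrite gtr0_norm ?invr_gt0// mulVf// gt_eqF.
  exact: scaled_ballZ.
rewrite (linear_onZ scaled_space_subspace phi_lin); last by exists c.
by rewrite normrM gtr0_norm ?invr_gt0// ler_pdivrMl.
Qed.

Lemma scaled_ball_sigma_convex (y : nat -> I * T -> R) : (forall k, B 1 (y k)) ->
  exists2 x, B 1 x &
    forall n, B 1 ((3 * 4 ^+ n) *: (x - \sum_(k < n) 4 ^- k.+1 *: y k)).
Proof.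
move=> By; pose v k := 4 ^- k.+1 *: y k; pose X n := \sum_(k < n) v k.
have Bv k : B (4 ^- k.+1) (v k).
  by have := scaled_ballZ (4 ^- k.+1) (By k); rewrite mulr1 ger0_norm// invr_ge0 exprn_ge0.
have Xcvg u : cvgn (X ^~ u).
  have -> : X ^~ u = series (v ^~ u).
    by apply/funext => n; rewrite /series/= big_mkord /X fct_sumE.
  apply: normed_cvg; apply: (@series_le_cvg _ _ (geometric 4^-1 4^-1)) => [n|n|n|].
  - exact: normr_ge0.
  - by rewrite /= mulr_ge0// exprn_ge0.
  - by rewrite /= -exprS exprVn; exact: (scaled_ball_norm_le u (Bv n)).
  - by apply: is_cvg_geometric_series; rewrite ger0_norm// invf_lt1// ltr1n.
pose x u := limn (X ^~ u).
have Btail m n : B (4 ^- m / 3) (X (m + n)%N - X m).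
  have -> : X (m + n)%N - X m = \sum_(k < n) v (m + k)%N.
    by rewrite /X big_split_ord/= addrAC subrr add0r.
  apply: (@scaled_ball_le (\sum_(k < n) 4 ^- (m + k).+1)).
  - by apply: sumr_ge0 => k _; rewrite invr_ge0 exprn_ge0.
  - have := @geometric_le_lim R n (4 ^- m.+1) 4^-1.
    rewrite /series/= big_mkord invr_ge0 exprn_ge0// ger0_norm// invf_lt1// ltr1n invr_gt0.
    move=> /(_ isT (ltr0n _ _) isT); rewrite exprS invfM.
    rewrite (_ : _ / (1 - 4^-1) = 4 ^- m / 3); last by field; rewrite expf_neq0.
    by apply: le_trans; apply: ler_sum => k _; rewrite -addSn exprD exprS !invfM exprVn.
  - by apply: (@scaled_ball_sum (fun k => 4 ^- (m + k).+1) (fun k => v (m + k)%N)) => [k|k];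
      rewrite ?invr_ge0 ?exprn_ge0.
have Bx m : B (4 ^- m / 3) (x - X m).
  apply: (scaled_ball_lim (Btail m)) => u; apply: cvgB; last exact: cvg_cst.
  rewrite (_ : (fun n => _) = [sequence X (n + m)%N u]_n).
    by rewrite (cvg_shiftn m (X ^~ u)); exact: Xcvg.
  by apply/funext => n; rewrite addnC.
exists x => [|n].
  have := Bx 0%N; rewrite /X big_ord0 subr0 expr0 invr1.
  by apply: scaled_ball_le => //; lra.
have := scaled_ballZ (3 * 4 ^+ n) (Bx n); rewrite ger0_norm ?mulr_ge0 ?exprn_ge0//.
by rewrite (_ : _ * (_ / 3) = 1)//; field; rewrite expf_neq0.
Qed.

Lemma scaled_ball_uniform_boundedness (phi : nat -> (I * T -> R) -> R) :
  (forall i, linear_on Y (phi i)) ->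
  (forall i, exists C, forall y, B 1 y -> `|phi i y| <= C) ->
  (forall y, B 1 y -> phi i y @[i --> \oo] --> 0) ->
  exists2 C : R, 0 < C & forall i y, B 1 y -> `|phi i y| <= C.
Proof.
move=> phi_lin phi_bdd phi_cvg0.
apply: (sigma_convex_uniform_boundedness scaled_space_subspace) => //.
- by move=> y; exact: scaled_ball_space.
- exact: scaled_ballN.
- by exists 0; exact: scaled_ball0.
- exact: scaled_ball_sigma_convex.
move=> y By; have /cvg_seq_bounded[C [_ phiC]] : cvgn (phi^~ y).
  by apply/cvg_ex; exists 0; exact: phi_cvg0.
by exists (C + 1) => i; apply: (phiC (C + 1)) => //; rewrite ltrDl.
Qed.

End ScaledBall.

Section QuadraticMean.
Context {R : realType} {d : measure_display} {T : measurableType d}.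
Variables (mu : {measure set T -> \bar R}) (I : Type) (tau : I -> \bar R).
Hypothesis tau_ge0 : forall j, (0 <= tau j)%E.
Local Notation B := (scaled_ball mu tau).
Local Notation Y := (scaled_space mu tau).
Implicit Types (y : I * T -> R) (c e : R).

(* [0] when [tau j] is [0] (the slice vanishes almost everywhere) or [+oo] (no constraint). *)
Definition quad_mean y (j : I) : R :=
  if (0 < tau j < +oo)%E then (\int[mu]_x (y (j, x)) ^+ 2) / fine (tau j) else 0.

Lemma scaled_ball_sq c y : 0 <= c -> B c y -> B (c ^+ 2) (y ^+ 2).
Proof.
move=> c0 By; have my := scaled_ball_measurable By.
have := scaled_ballZ c By; rewrite ger0_norm// -expr2 => /scaled_ball_dom; apply.
  by rewrite expr2; exact: slice_measurableM.
move=> u; rewrite !fctE /GRing.scale/= expr2 !normrM (ger0_norm c0).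
by rewrite ler_wpM2r// (scaled_ball_norm_le u By).
Qed.

Lemma scaled_space_sq y : Y y -> Y (y ^+ 2).
Proof.
by move=> [c c0 By]; exists (c ^+ 2); [exact: exprn_gt0|apply: scaled_ball_sq => //; exact: ltW].
Qed.

Lemma slice_integrable y j : Y y -> (tau j < +oo)%E ->
  mu.-integrable setT (EFin \o (fun x => y (j, x))).
Proof.
move=> [c c0 By] tauj; apply/integrableP; split.
  by apply/measurable_EFinP; exact: (scaled_ball_measurable By j).
apply: le_lt_trans (scaled_ball_integral_le j By) _.
by rewrite lte_mul_pinfty// lee_fin ltW.
Qed.

Lemma Rintegral_slice_sq y j : Y y -> (tau j < +oo)%E ->
  (\int[mu]_x ((y (j, x)) ^+ 2)%:E)%E = (\int[mu]_x (y (j, x)) ^+ 2)%:E.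
Proof.
move=> Yy tauj; rewrite /Rintegral fineK//.
exact: (integrable_fin_num measurableT (slice_integrable (scaled_space_sq Yy) tauj)).
Qed.

Lemma integral_slice_sq_le c y j : 0 <= c -> B c y ->
  (\int[mu]_x ((y (j, x)) ^+ 2)%:E <= (c ^+ 2)%:E * tau j)%E.
Proof.
move=> c0 By; apply: le_trans (scaled_ball_integral_le j (scaled_ball_sq c0 By)).
by under [leRHS]eq_integral do rewrite fctE ger0_norm ?sqr_ge0//.
Qed.

Lemma quad_mean_ge0 y j : 0 <= quad_mean y j.
Proof.
rewrite /quad_mean; case: ifP => // _; apply: divr_ge0; last exact: fine_ge0.
by apply: Rintegral_ge0 => x _; rewrite sqr_ge0.
Qed.

Lemma quad_mean_le c y j : 0 < c -> B c y -> quad_mean y j <= c ^+ 2.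
Proof.
move=> c0 By; rewrite /quad_mean; case: ifPn => [/andP[t0 tauj]|_]; last exact/exprn_ge0/ltW.
have tauf : tau j \is a fin_num by rewrite ge0_fin_numE.
rewrite ler_pdivrMr ?fine_gt0 ?t0// -lee_fin -Rintegral_slice_sq//; last by exists c.
by rewrite EFinM fineK//; apply: integral_slice_sq_le => //; exact: ltW.
Qed.

Lemma quad_mean_parallelogram v w j : Y v -> Y w ->
  4 * quad_mean (2^-1 *: (v + w)) j + quad_mean (v - w) j = 2 * quad_mean v j + 2 * quad_mean w j.
Proof.
move=> Yv Yw; rewrite /quad_mean; case: ifPn => [/andP[t0 tauj]|_]; last by ring.
rewrite !mulrA -!mulrDl; congr (_ / _).
have subY := scaled_space_subspace mu tau_ge0.
have sq_int y : Y y -> mu.-integrable setT (EFin \o (fun x => (y (j, x)) ^+ 2)).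
  by move=> Yy; exact: (slice_integrable (scaled_space_sq Yy) tauj).
have vw_int : mu.-integrable setT (EFin \o (fun x => ((2^-1 *: (v + w)) (j, x)) ^+ 2)).
  by apply: sq_int; apply: linear_subspaceZ => //; exact: linear_subspaceD.
have vBw_int : mu.-integrable setT (EFin \o (fun x => ((v - w) (j, x)) ^+ 2)).
  by apply: sq_int; exact: linear_subspaceB.
rewrite -!RintegralZl//; [|exact: sq_int|exact: sq_int].
rewrite -!RintegralD//.
- by apply: eq_Rintegral => x _; rewrite !fctE /GRing.scale/=; field.
- exact: (integrableZl measurableT 2 (sq_int _ Yv)).
- exact: (integrableZl measurableT 2 (sq_int _ Yw)).
- exact: (integrableZl measurableT 4 vw_int).
Qed.

Lemma integral_slice_sq_quad_mean y j e : Y y -> 0 < e -> quad_mean y j <= e ->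
  (\int[mu]_x ((y (j, x)) ^+ 2)%:E <= e%:E * tau j)%E.
Proof.
move=> Yy e0; rewrite /quad_mean; case: ifPn => [/andP[t0 tauj]|].
  have tauf : tau j \is a fin_num by rewrite ge0_fin_numE.
  by rewrite Rintegral_slice_sq// -(fineK tauf) -EFinM lee_fin -ler_pdivrMr ?fine_gt0 ?t0.
rewrite negb_and -!leNgt => /orP[t0|tauj] _; last first.
  have -> : tau j = +oo%E by apply/eqP; rewrite -leye_eq.
  by rewrite gt0_muley ?lte_fin// leey.
have [b b0 By] := Yy; have := integral_slice_sq_le j (ltW b0) By.
by rewrite (_ : tau j = 0%E) ?mule0//; apply/eqP; rewrite eq_le t0 tau_ge0.
Qed.

Lemma quad_mean_markov y j c e : Y y -> 0 < c -> 0 < e -> quad_mean y j <= c ^+ 2 * e ->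
  (mu [set x | (c < `|y (j, x)|)%R] <= e%:E * tau j)%E.
Proof.
move=> Yy c0 e0 qe; have my := scaled_space_measurable Yy j.
have c20 : 0 < c ^+ 2 by rewrite exprn_gt0.
have mysq : measurable_fun setT (fun x => ((y (j, x)) ^+ 2)%:E).
  by apply/measurable_EFinP; exact: measurable_funX.
rewrite -(@lee_pmul2l _ (c ^+ 2)%:E)// muleA -EFinM.
have int_le := integral_slice_sq_quad_mean Yy (mulr_gt0 c20 e0) qe.
apply: le_trans int_le.
have := le_integral_abse mu measurableT mysq c20.
under eq_integral do rewrite abse_EFin ger0_norm ?sqr_ge0//.
apply: le_trans; apply: lee_wpmul2l; first by rewrite lee_fin ltW.
apply: le_measure; rewrite ?inE; first exact: measurable_norm_gt.
  by apply: emeasurable_fun_c_infty => //; exact: measurableT_comp.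
move=> x /= cy; split => //; rewrite lee_fin ger0_norm ?sqr_ge0//.
by rewrite -[leRHS]real_normK ?num_real// ler_sqr ?nnegrE ?(ltW c0)// ltW.
Qed.

End QuadraticMean.

(** * Weak-* null sequences *)

Section WeakStarNull.
Context {R : realType} {d : measure_display} {T : measurableType d}.
Variables (mu : {measure set T -> \bar R}) (I : Type) (tau : I -> \bar R).
Hypothesis tau_ge0 : forall j, (0 <= tau j)%E.
Local Notation B := (scaled_ball mu tau).
Local Notation Y := (scaled_space mu tau).
Local Notation mean2 := (quad_mean mu tau).
Variables (phi : nat -> (I * T -> R) -> R) (C : R).
Hypotheses (phi_linear : forall i, linear_on Y (phi i))
  (phi_le : forall i y, B 1 y -> `|phi i y| <= C)
  (phi_cvg0 : forall y, B 1 y -> phi i y @[i --> \oo] --> 0)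
  (phi_flat : forall e : R, 0 < e -> exists2 r : R, 0 < r &
     forall i y, B 1 y -> (forall u, `|y u| <= r) -> `|phi i y| <= e).
Implicit Types (m y z : I * T -> R) (c e : R) (J : set I) (E : set (I * T)).

Let subY : linear_subspace Y := scaled_space_subspace mu tau_ge0.
Let BY c y : 0 <= c -> B c y -> Y y. Proof. exact: scaled_ball_space. Qed.

Definition scale_multipliers : set (I * T -> R) :=
  [set a \o fst | a in [set a : I -> R | (forall j, 0 <= a j) /\ exists c, forall j, a j <= c]].

Definition space_multipliers : set (I * T -> R) := [set m | (forall u, 0 <= m u) /\ Y m].

Definition unit_tests : set (I * T -> R) :=
  [set y | slice_measurable y /\ forall u, `|y u| <= 1].

Lemma functional_scaled_ball_le i c y : 0 < c -> B c y -> `|phi i y| <= c * C.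
Proof. exact: (scaled_ball_functional_le tau_ge0 (phi_linear i) (phi_le i)). Qed.

Lemma scale_multipliers_ball m : scale_multipliers m ->
  exists2 c, 0 < c & forall y, B 1 y -> B c (m * y).
Proof.
move=> [a [a0 [c ac]] <-]; exists (`|c| + 1) => [|y By]; first by rewrite ltr_wpDl.
apply: scaled_ball_scale => // j; rewrite ger0_norm//.
by rewrite (le_trans (ac j))// (le_trans (ler_norm c))// lerDl.
Qed.

Lemma scale_modulus_data i : modulus_data scale_multipliers (B 1) Y (phi i).
Proof.
split => //.
- move=> _ _ [a [a0 [c ac]] <-] [a' [a'0 [c' ac']] <-]; exists (a + a') => //.
  split=> [j|]; first by rewrite fctE addr_ge0.
  by exists (c + c') => j; rewrite fctE lerD.
- move=> _ _ [a [a0 _] <-] [a' [a'0 [c' ac']] <-] aa'.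
  exists (fun j => Num.max 0 (a' j - a j)); last first.
    by apply/funext => u; rewrite !fctE/= max_r// subr_ge0; exact: aa'.
  split=> [j|]; first by rewrite le_max lexx.
  exists c' => j; rewrite ge_max (le_trans (a'0 j) (ac' j))/=.
  by apply: le_trans (ac' j); rewrite gerBl.
- move=> b _ b0 [a [a0 [c ac]] <-]; exists (b *: a) => //.
  split=> [j|]; first by rewrite fctE mulr_ge0.
  by exists (b * c) => j; rewrite fctE ler_wpM2l.
- exact: scaled_ball0.
- by move=> y; exact: scaled_ballN.
- move=> _ _ y y' [a [a0 _] <-] [a' [a'0 _] <-] By By'.
  pose t j := a' j / (a j + a' j).
  have t01 j : 0 <= t j <= 1.
    rewrite /t divr_ge0 ?addr_ge0//=; have [s0|s0] := eqVneq (a j + a' j) 0.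
      by rewrite s0 invr0 mulr0.
    by rewrite ler_pdivrMr ?mul1r ?lerDr// lt_neqAle eq_sym s0 addr_ge0.
  exists (fun u => (1 - t u.1) * y u + t u.1 * y' u).
    apply: scaled_ball_slices => j; exists ((1 - t j) *: y + t j *: y') => //.
    exact: scaled_ball_convex.
  apply/funext => u; rewrite !fctE/= /t; have [/eqP|s0] := eqVneq (a u.1 + a' u.1) 0.
    by rewrite paddr_eq0// => /andP[/eqP -> /eqP ->]; rewrite !(mul0r, addr0).
  by field.
- by move=> m y /scale_multipliers_ball[c /ltW c0 Bm] /Bm; exact: BY.
- move=> m /scale_multipliers_ball[c c0 Bm]; exists (c * C) => _ [y /Bm By <-].
  by apply: le_trans (ler_norm _) _; exact: functional_scaled_ball_le.
Qed.

Lemma unit_tests_mul c m y : B c m -> unit_tests y -> B c (m * y).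
Proof. by move=> Bm [my y1]; exact: scaled_ball_mul. Qed.

Lemma space_modulus_data i : modulus_data space_multipliers unit_tests Y (phi i).
Proof.
split => //.
- move=> m m' [m0 Ym] [m'0 Ym']; split; last exact: linear_subspaceD.
  by move=> u; rewrite fctE addr_ge0.
- move=> m m' [m0 Ym] [m'0 Ym'] mm'; split; last exact: linear_subspaceB.
  by move=> u; rewrite !fctE subr_ge0.
- move=> c m c0 [m0 Ym]; split; last exact: linear_subspaceZ.
  by move=> u; rewrite fctE mulr_ge0.
- split; first by move=> j; exact: (measurable_cst (0 : R)).
  by move=> u; rewrite normr0.
- move=> y [my y1]; split; last by move=> u; rewrite normrN.
  by move=> j; exact: measurable_funN.
- move=> m m' y y' [m0 Ym] [m'0 Ym'] [my y1] [my' y'1].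
  have mm := scaled_space_measurable Ym; have mm' := scaled_space_measurable Ym'.
  pose w u := (m u * y u + m' u * y' u) * (m u + m' u) `^ (-1).
  have wE u : w u = (m u * y u + m' u * y' u) / (m u + m' u).
    by rewrite /w powR_inv1// addr_ge0.
  exists w; last first.
    apply/funext => u; rewrite !fctE wE; have [/eqP|s0] := eqVneq (m u + m' u) 0.
      by rewrite paddr_eq0// => /andP[/eqP -> /eqP ->]; rewrite !(mul0r, addr0).
    by rewrite [RHS]mulrC divfK.
  split=> [j|u].
    apply: measurable_funM; first by apply: measurable_funD; exact: measurable_funM.
    apply: (measurableT_comp (measurable_powR (-1))).
    by apply: measurable_funD; [exact: mm|exact: mm'].
  rewrite wE; have [->|s0] := eqVneq (m u + m' u) 0; first by rewrite invr0 mulr0 normr0.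
  have s1 : 0 < m u + m' u by rewrite lt_neqAle eq_sym s0 addr_ge0.
  rewrite normrM normfV (gtr0_norm s1) ler_pdivrMr// mul1r.
  apply: (le_trans (ler_normD _ _)); rewrite !normrM (ger0_norm (m0 u)) (ger0_norm (m'0 u)).
  by apply: lerD; rewrite ler_piMr.
- by move=> m y [_ [c /ltW c0 Bm]] Wy; apply: (BY c0); exact: unit_tests_mul.
- move=> m [_ [c c0 Bm]]; exists (c * C) => _ [y Wy <-].
  apply: le_trans (ler_norm _) _; apply: functional_scaled_ball_le => //.
  exact: unit_tests_mul.
Qed.

Local Notation scale_modulus i := (modulus (B 1) (phi i)).
Local Notation space_modulus i := (modulus unit_tests (phi i)).

Lemma scale_multipliers_indic J : scale_multipliers \1_(fst @^-1` J).
Proof.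
exists \1_J; last by rewrite indic_comp.
by split=> [j|]; [rewrite indicE|exists 1 => j; exact: indic_le1].
Qed.

Lemma scale_indic_ball J y : B 1 y -> B 1 (\1_(fst @^-1` J) * y).
Proof.
move=> By; rewrite indic_comp; apply: scaled_ball_scale => // j.
by rewrite ger0_norm ?indic_le1// indicE.
Qed.

(* [scale_modulus i \1_(fst @^-1` J)] is the norm of [phi i] restricted to the scales in [J];
   elements of the ball on disjoint sets of scales glue to an element of the ball. *)
Lemma scale_uniform_continuity e : 0 < e -> exists k : nat, forall J,
  (forall i, (i <= k)%N -> scale_modulus i \1_(fst @^-1` J) <= 2 ^- k) ->
  forall i, scale_modulus i \1_(fst @^-1` J) <= e.
Proof.
move=> e0; apply: contrapT => discontinuous.
have /choice[J hJ] k : exists J : set I,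
    (forall i, (i <= k)%N -> scale_modulus i \1_(fst @^-1` J) <= 2 ^- k) /\
    exists i, e <= scale_modulus i \1_(fst @^-1` J).
  apply: contrapT => h; apply: discontinuous; exists k => J hJ i.
  rewrite leNgt; apply/negP => h'; apply: h; exists J; split => //.
  by exists i; exact: ltW.
pose F : set (set (I * T)) := [set fst @^-1` J | J in setT].
apply: (@modulus_uniform_absolute_continuity _ _ scale_multipliers (B 1) Y phi F C
  scale_modulus_data _ _ _ _ _ (fun k => fst @^-1` (J k)) e e0 _ (fun k => (hJ k).1)
  (fun k => (hJ k).2)).
- split; first by exists set0.
  + by move=> _ _ [A _ <-] [A' _ <-]; exists (A `\` A').
  + move=> A FA; have /choice[A' hA] n : exists J, fst @^-1` J = A n.
      by have [J' _ <-] := FA n; exists J'.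
    exists (\bigcup_n A' n) => //; rewrite preimage_bigcup.
    by apply: eq_bigcupr => n _; exact: hA.
- by move=> _ [A _ <-]; exact: scale_multipliers_indic.
- move=> D z FD tD Bz; apply: scaled_ball_slices => j.
  have [[k Dk]|nD] := pselect (exists k, forall x, D k (j, x)).
    by exists (z k) => // x; exact: glue_seqE.
  exists 0; first exact: scaled_ball0.
  move=> x; apply: glue_seq0 => -[k _ Dk]; apply: nD; exists k => x'.
  by move: Dk; have [A _ <-] := FD k.
- by move=> _ y [A _ <-] By; apply: phi_cvg0; exact: scale_indic_ball.
- move=> i _ y [A _ <-] By; apply: le_trans (ler_norm _) _; apply: phi_le.
  exact: scale_indic_ball.
- by move=> k; exists (J k).
Qed.

Lemma unit_tests_glue_seq (D : nat -> set (I * T)) (z : nat -> I * T -> R) :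
  (forall k j, measurable [set x | D k (j, x)]) -> trivIset setT D ->
  (forall k, unit_tests (z k)) -> unit_tests (glue_seq D z).
Proof.
move=> mD tD Wz; split=> [j|u]; last first.
  have [[k _ Dk]|nDu] := pselect ((\bigcup_k D k) u).
    by rewrite (glue_seqE z tD Dk); exact: (Wz k).2.
  by rewrite glue_seq0// normr0.
apply: (@measurable_fun_cvg _ _ _ setT (fun n x => \sum_(k < n) \1_(D k) (j, x) * z k (j, x))).
  move=> n; apply: measurable_sum => k; apply: measurable_funM; last exact: (Wz k).1.
  exact: (slice_measurable_indic (mD k) j).
move=> x _; have [[k _ Dk]|nDx] := pselect ((\bigcup_k D k) (j, x)).
  rewrite (glue_seqE z tD Dk); apply: cvg_near_cst; exists k.+1 => // n /= kn; apply/eqP.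
  rewrite (bigD1 (Ordinal kn))//= indicE mem_set// mul1r big1 ?addr0// => l /eqP lk.
  rewrite indicE memNset ?mul0r// => Dl; apply: lk; apply/val_inj => /=.
  by apply: tD => //; exists (j, x).
rewrite glue_seq0//; apply: cvg_near_cst; apply: nearW => n; apply/eqP; rewrite big1// => k _.
by rewrite indicE memNset ?mul0r// => Dk; apply: nDx; exists k.
Qed.

Lemma space_uniform_continuity E (A : nat -> set (I * T)) e :
  0 < e -> (forall j, measurable [set x | E (j, x)]) -> B 1 \1_E ->
  (forall k j, measurable [set x | A k (j, x)]) -> (forall k, A k `<=` E) ->
  (forall k i, (i <= k)%N -> space_modulus i \1_(A k) <= 2 ^- k) ->
  ~ forall k, exists i, e <= space_modulus i \1_(A k).
Proof.
move=> e0 mE BE mA AE.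
pose F : set (set (I * T)) := [set D | D `<=` E /\ forall j, measurable [set x | D (j, x)]].
have F_ball D : F D -> B 1 \1_D.
  move=> [DE mD]; apply: (scaled_ball_dom BE); first exact: slice_measurable_indic.
  move=> u; rewrite !indicE !ger0_norm// ler_nat.
  by have [/set_mem/DE Eu|//] := boolP (u \in D); rewrite mem_set.
have F_mul_ball D y : F D -> unit_tests y -> B 1 (\1_D * y).
  by move=> /F_ball BD; exact: unit_tests_mul.
apply: (@modulus_uniform_absolute_continuity _ _ space_multipliers unit_tests Y phi F C
  space_modulus_data) => //.
- split.
  + by split=> [//|j]; rewrite (_ : [set x | _] = set0).
  + move=> D D' [DE mD] [_ mD']; split; first by move=> u [/DE].
    by move=> j; exact: (measurableD (mD j) (mD' j)).
  + move=> D FD; split; first by move=> u [n _] /(FD n).1.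
    move=> j; rewrite -[X in measurable X]/(pair j @^-1` (\bigcup_n D n)) preimage_bigcup.
    by apply: bigcup_measurable => n _; exact: (FD n).2.
- move=> D FD; split; first by move=> u; rewrite indicE.
  by apply: (BY ler01); exact: F_ball.
- by move=> D z FD; apply: unit_tests_glue_seq => k; exact: (FD k).2.
- by move=> D y FD Wy; apply: phi_cvg0; exact: F_mul_ball.
- by move=> i D y FD Wy; apply: le_trans (ler_norm _) _; apply: phi_le; exact: F_mul_ball.
Qed.

Lemma sq_space_multipliers y : Y y -> space_multipliers (y ^+ 2).
Proof. by move=> Yy; split; [move=> u; rewrite fctE sqr_ge0|exact: scaled_space_sq]. Qed.

Lemma quad_mean_scale_multipliers y : Y y -> scale_multipliers (mean2 y \o fst).
Proof.
move=> [c c0 By]; exists (mean2 y) => //; split=> [j|]; first exact: quad_mean_ge0.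
by exists (c ^+ 2) => j; exact: quad_mean_le.
Qed.

Lemma scale_modulus_ge0 i y : Y y -> 0 <= scale_modulus i (mean2 y \o fst).
Proof. by move=> /quad_mean_scale_multipliers/(modulus_ge0 (scale_modulus_data i)). Qed.

Lemma space_modulus_ge0 i y : Y y -> 0 <= space_modulus i (y ^+ 2).
Proof. by move=> /sq_space_multipliers/(modulus_ge0 (space_modulus_data i)). Qed.

Definition quad_form n y : R :=
  \sum_(i < n) (space_modulus i (y ^+ 2) + scale_modulus i (mean2 y \o fst)).

Lemma le_quad_form n i y : Y y -> (i < n)%N ->
  space_modulus i (y ^+ 2) <= quad_form n y /\
  scale_modulus i (mean2 y \o fst) <= quad_form n y.
Proof.
move=> Yy ilt; rewrite /quad_form (bigD1 (Ordinal ilt))//=.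
have := space_modulus_ge0 i Yy; have := scale_modulus_ge0 i Yy.
set s := \sum_(_ < _ | _) _; have : 0 <= s; last by lra.
by apply: sumr_ge0 => j _; rewrite addr_ge0 ?space_modulus_ge0 ?scale_modulus_ge0.
Qed.

Lemma quad_form_ge0 n y : Y y -> 0 <= quad_form n y.
Proof.
by move=> Yy; apply: sumr_ge0 => i _; rewrite addr_ge0 ?space_modulus_ge0 ?scale_modulus_ge0.
Qed.

Lemma quad_form_le n y : B 1 y -> quad_form n y <= n%:R * (C + C).
Proof.
move=> By; rewrite -[n in leRHS]card_ord mulr_natl -sumr_const; apply: ler_sum => i _.
have norm_le_C z : B 1 z -> phi i z <= C.
  by move=> Bz; apply: le_trans (ler_norm _) _; exact: phi_le.
apply: lerD.
  apply: (modulus_le_ub (space_modulus_data i)) => w Ww; apply: norm_le_C.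
  by apply: unit_tests_mul Ww; rewrite -(expr1n _ 2); exact: scaled_ball_sq.
apply: (modulus_le_ub (scale_modulus_data i)) => w Bw; apply: norm_le_C.
apply: scaled_ball_scale => // j; rewrite ger0_norm ?quad_mean_ge0//.
by have := quad_mean_le tau_ge0 j ltr01 By; rewrite expr1n.
Qed.

Lemma quad_form_parallelogram n v w : Y v -> Y w ->
  4 * quad_form n (2^-1 *: (v + w)) + quad_form n (v - w) =
  2 * quad_form n v + 2 * quad_form n w.
Proof.
move=> Yv Yw; rewrite /quad_form !mulr_sumr -!big_split/=; apply: eq_bigr => i _.
have Yvw : Y (2^-1 *: (v + w)) by apply: linear_subspaceZ => //; exact: linear_subspaceD.
have YvBw : Y (v - w) by exact: linear_subspaceB.
have := modulus_parallelogram (space_modulus_data i) (sq_space_multipliers Yvw)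
  (sq_space_multipliers YvBw) (sq_space_multipliers Yv) (sq_space_multipliers Yw).
have := modulus_parallelogram (scale_modulus_data i) (quad_mean_scale_multipliers Yvw)
  (quad_mean_scale_multipliers YvBw) (quad_mean_scale_multipliers Yv)
  (quad_mean_scale_multipliers Yw).
have -> : 4 *: (mean2 (2^-1 *: (v + w)) \o fst) + (mean2 (v - w) \o fst) =
    2 *: (mean2 v \o fst) + 2 *: (mean2 w \o fst) :> (I * T -> R).
  by apply/funext => u; exact: (quad_mean_parallelogram tau_ge0 u.1 Yv Yw).
have -> : 4 *: (2^-1 *: (v + w)) ^+ 2 + (v - w) ^+ 2 = 2 *: v ^+ 2 + 2 *: w ^+ 2.
  by apply/funext => u; rewrite !fctE /GRing.scale/=; field.
by move=> /(_ erefl) + /(_ erefl); lra.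
Qed.

Lemma quad_form_half n y : Y y -> 4 * quad_form n (2^-1 *: y) = quad_form n y.
Proof.
move=> Yy; have Y0 := linear_subspace0 subY.
have := quad_form_parallelogram n Yy Y0; have := quad_form_parallelogram n Y0 Y0.
by rewrite !(addr0, subr0, scaler0); lra.
Qed.

Definition jointly_large (e : R) := forall n,
  exists2 y, B 1 y & forall i, (i <= n)%N -> e <= phi i y.

Lemma quad_form_small_difference e n (eta : R) : 0 < e -> jointly_large e -> 0 < eta ->
  exists i z, [/\ B 1 z, e / 4 <= phi i z & quad_form n z <= eta].
Proof.
move=> e0 large eta0; pose S N := [set y | B 1 y /\ forall i, (i <= N)%N -> e <= phi i y].
have S_convex N : convex_in (S N).
  move=> t v w t01 [Bv ev] [Bw ew]; split; first exact: scaled_ball_convex.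
  move=> i iN; have Yv := BY ler01 Bv; have Yw := BY ler01 Bw.
  have [Ytv Ytw] : Y ((1 - t) *: v) /\ Y (t *: w) by split; exact: linear_subspaceZ.
  rewrite (linear_onD (phi_linear i))// !(linear_onZ subY (phi_linear i))//.
  have /andP[t0 t1] := t01; have := ev i iN; have := ew i iN.
  by nra.
have [||||m [z0 [[Bz0 _] near_z0]]] := @decreasing_convex_near _ _ (quad_form n) S
  (n%:R * (C + C)) eta _ _ _ S_convex _ eta0.
- by move=> v [Bv _]; rewrite quad_form_le// andbT; exact/quad_form_ge0/(BY ler01).
- by move=> a b ab v [Bv ev]; split => // i ia; apply: ev; exact: leq_trans ab.
- by move=> N; have [y By ey] := large N; exists y.
- by move=> v w [Bv _] [Bw _]; apply: quad_form_parallelogram; exact: (BY ler01).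
have [i mi iz0] : exists2 i, (m <= i)%N & `|phi i z0| <= e / 2.
  have [M _ hM] : \forall i \near \oo, `|phi i z0| <= e / 2.
    move/cvgrPdist_le : (phi_cvg0 Bz0) => /(_ _ (divr_gt0 e0 (ltr0n _ 2))); apply: filterS => i.
    by rewrite sub0r normrN.
  by exists (maxn m M); [exact: leq_maxl|apply: hM => /=; exact: leq_maxr].
have [z [Bz ez] qz] := near_z0 i mi; exists i, (2^-1 *: (z - z0)).
have Yz := BY ler01 Bz; have Yz0 := BY ler01 Bz0; have Yzz0 := linear_subspaceB subY Yz Yz0.
split.
- have := scaled_ballZ 2^-1 (scaled_ballD ler01 ler01 Bz (scaled_ballN Bz0)).
  by rewrite ger0_norm// (_ : 2^-1 * (1 + 1) = 1)//; field.
- rewrite (linear_onZ subY (phi_linear i))// (linear_onB (phi_linear i))//.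
  by have := ez i (leqnn _); move: iz0 => /ler_normlW; lra.
- have := quad_form_half n Yzz0; have := quad_form_ge0 n Yzz0; lra.
Qed.

(* The part where [z] exceeds [s], on the scales on which its quadratic mean is at most [r]. *)
Definition large_part z (r s : R) : set (I * T) := [set u | mean2 z u.1 <= r /\ s < `|z u|].

Lemma measurable_large_part z r s j : Y z -> measurable [set x | large_part z r s (j, x)].
Proof.
move=> Yz; have [zr|zr] := pselect (mean2 z j <= r).
  rewrite (_ : [set x | _] = [set x | s < `|z (j, x)|]).
    by apply: measurable_norm_gt; exact: (scaled_space_measurable Yz j).
  by apply/seteqP; split => x /=; [case|split].
by rewrite (_ : [set x | _] = set0)//; apply/seteqP; split => x //= -[].
Qed.

Lemma large_part_measure_le z e s j : Y z -> 0 < s -> 0 < e ->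
  (mu [set x | large_part z (s ^+ 2 * e) s (j, x)] <= e%:E * tau j)%E.
Proof.
move=> Yz s0 e0; have mA := measurable_large_part (s ^+ 2 * e) s j Yz.
have [zr|zr] := pselect (mean2 z j <= s ^+ 2 * e); last first.
  rewrite (_ : [set x | _] = set0) ?measure0 ?mule_ge0// ?lee_fin ?ltW//.
  by apply/seteqP; split => x //= -[].
apply: le_trans (quad_mean_markov tau_ge0 Yz s0 e0 zr).
apply: le_measure; rewrite ?inE//; last by move=> x [].
by apply: measurable_norm_gt; exact: (scaled_space_measurable Yz j).
Qed.

Lemma large_part_space_multipliers z r s : Y z -> 0 < s ->
  space_multipliers \1_(large_part z r s).
Proof.
move=> Yz s0; split; first by move=> u; rewrite indicE.
have [c c0 Bc] := linear_subspaceZ subY ((s ^+ 2)^-1) (scaled_space_sq Yz); exists c => //.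
apply: (scaled_ball_dom Bc).
  by apply: slice_measurable_indic => j; exact: measurable_large_part.
move=> u; rewrite !fctE /GRing.scale/= ger0_norm ?indicE// normrM normfV !ger0_norm ?sqr_ge0//.
have [/set_mem[_ zu]|_] := boolP (u \in _); last by rewrite mulr_ge0 ?invr_ge0 ?sqr_ge0.
rewrite ler_pdivlMl ?exprn_gt0// mulr1 -[leRHS]real_normK ?num_real//.
by rewrite ler_sqr ?nnegrE ?(ltW s0)// ltW.
Qed.

Lemma space_modulus_large_part_le i z r s : Y z -> 0 < s ->
  s ^+ 2 * space_modulus i \1_(large_part z r s) <= space_modulus i (z ^+ 2).
Proof.
move=> Yz s0; apply: (modulus_markov (space_modulus_data i)).
- exact: exprn_gt0.
- exact: large_part_space_multipliers.
- exact: sq_space_multipliers.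
- by move=> u; rewrite fctE sqr_ge0.
move=> u [_ zu]; rewrite fctE -[leRHS]real_normK ?num_real//.
by rewrite ler_sqr ?nnegrE ?(ltW s0)// ltW.
Qed.

Lemma scale_modulus_large_mean_le i z r : Y z -> 0 < r ->
  r * scale_modulus i \1_(fst @^-1` [set j | r < mean2 z j]) <= scale_modulus i (mean2 z \o fst).
Proof.
move=> Yz r0; apply: (modulus_markov (scale_modulus_data i)) => //.
- exact: scale_multipliers_indic.
- exact: quad_mean_scale_multipliers.
- by move=> u /=; exact: quad_mean_ge0.
- by move=> u /ltW.
Qed.

(* Outside the scales of large quadratic mean and outside its large part, [z] is flat. *)
Lemma functional_le_large_part i z r s e : B 1 z -> 0 < s ->
  (forall y, B 1 y -> (forall u, `|y u| <= s) -> `|phi i y| <= e) ->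
  phi i z <= scale_modulus i \1_(fst @^-1` [set j | r < mean2 z j])
    + space_modulus i \1_(large_part z r s) + e.
Proof.
move=> Bz s0 flat; have Yz := BY ler01 Bz; set J := fst @^-1` _; set A := large_part z r s.
have JA0 : J `&` A = set0.
  by rewrite -subset0 => u [ru [zu _]]; move: ru; rewrite /J/= ltNge zu.
have mJA : slice_measurable (\1_(J `|` A) : I * T -> R).
  rewrite indicDU// => j; apply: measurable_funD.
    by rewrite /J indic_comp; exact: slice_measurable_comp_fst.
  by apply: slice_measurable_indic => {}j; exact: measurable_large_part.
have BJA : B 1 (\1_(J `|` A) * z).
  rewrite mulrC; apply: scaled_ball_mul => // u.
  by rewrite ger0_norm ?indic_le1// indicE.
have zE u : (z - \1_(J `|` A) * z) u = z u /\ `|z u| <= s \/ (z - \1_(J `|` A) * z) u = 0.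
  rewrite !fctE indicE; have [_|nJAu] := boolP (u \in J `|` A).
    by right; rewrite mul1r subrr.
  left; rewrite mul0r subr0; split => //; rewrite leNgt; apply/negP => zu.
  move/negP : nJAu; apply; apply/mem_set; have [rz|zr] := ltP r (mean2 z u.1); first by left.
  by right.
have Bflat : B 1 (z - \1_(J `|` A) * z).
  apply: (scaled_ball_dom Bz).
    apply: slice_measurableB; first exact: (scaled_ball_measurable Bz).
    exact: (scaled_ball_measurable BJA).
  by move=> u; have [[-> _]|->] := zE u; rewrite ?normr0.
have : `|phi i (z - \1_(J `|` A) * z)| <= e.
  by apply: flat => // u; have [[-> //]|->] := zE u; rewrite normr0 ltW.
have -> : \1_(J `|` A) * z = \1_J * z + \1_A * z by rewrite indicDU// mulrDl.
have MJ : scale_multipliers \1_J by exact: scale_multipliers_indic.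
have MA : space_multipliers \1_A by exact: large_part_space_multipliers.
have Tz : unit_tests z.
  split; first exact: (scaled_ball_measurable Bz).
  by move=> u; exact: (scaled_ball_norm_le u Bz).
have YJ : Y (\1_J * z) := multiplier_test (scale_modulus_data i) MJ Bz.
have YA : Y (\1_A * z) := multiplier_test (space_modulus_data i) MA Tz.
rewrite (linear_onB (phi_linear i))//; last exact: linear_subspaceD.
rewrite (linear_onD (phi_linear i))// => /ler_normlW.
have := le_functional_modulus (scale_modulus_data i) MJ Bz.
have := le_functional_modulus (space_modulus_data i) MA Tz.
lra.
Qed.

Lemma small_support_piece e (k : nat) : 0 < e -> jointly_large e ->
  exists Ai : set (I * T) * nat,
    [/\ forall j, measurable [set x | Ai.1 (j, x)],
        forall j, (mu [set x | Ai.1 (j, x)] <= (2 ^- k.+1)%:E * tau j)%E,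
        forall i, (i <= k)%N -> space_modulus i \1_(Ai.1) <= 2 ^- k &
        e / 8 <= space_modulus Ai.2 \1_(Ai.1)].
Proof.
move=> e0 large; have e160 : 0 < e / 16 by rewrite divr_gt0.
have [l hl] := scale_uniform_continuity e160; have [s s0 flat] := phi_flat e160.
have pow_gt0 q : 0 < 2 ^- q :> R by rewrite invr_gt0 exprn_gt0.
have s20 : 0 < s ^+ 2 by rewrite exprn_gt0.
pose r := s ^+ 2 * 2 ^- k.+1; have r0 : 0 < r by rewrite mulr_gt0.
pose eta := Num.min (r * 2 ^- l) (s ^+ 2 * 2 ^- k).
have eta0 : 0 < eta by rewrite lt_min !mulr_gt0.
pose n := (maxn k l).+1.
have [i [z [Bz ez qz]]] := quad_form_small_difference n e0 large eta0.
have Yz := BY ler01 Bz.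
have scale_le : scale_modulus i \1_(fst @^-1` [set j | r < mean2 z j]) <= e / 16.
  apply: hl => j jl; rewrite -(ler_pM2l r0).
  apply: le_trans (scale_modulus_large_mean_le j Yz r0) _.
  have [|_] := @le_quad_form n j _ Yz; first by rewrite ltnS leq_max jl orbT.
  by move=> /le_trans; apply; rewrite (le_trans qz)// ge_min lexx.
exists (large_part z r s, i); split => /= [j|j|j jk|].
- exact: measurable_large_part.
- by apply: large_part_measure_le.
- rewrite -(ler_pM2l s20); apply: le_trans (space_modulus_large_part_le j r Yz s0) _.
  have [|+ _] := @le_quad_form n j _ Yz; first by rewrite ltnS leq_max jk.
  by move=> /le_trans; apply; rewrite (le_trans qz)// ge_min lexx orbT.
by have := functional_le_large_part r Bz s0 (flat i); lra.
Qed.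

Theorem not_jointly_large e : 0 < e -> ~ jointly_large e.
Proof.
move=> e0 large; have /choice[Ai hAi] k := small_support_piece k e0 large.
pose A k := (Ai k).1; pose E := \bigcup_k A k.
have mA k j : measurable [set x | A k (j, x)] by have [+ _ _ _] := hAi k; exact.
have Ej j : [set x | E (j, x)] = \bigcup_k [set x | A k (j, x)].
  by rewrite -[LHS]/(pair j @^-1` E) preimage_bigcup.
have mE j : measurable [set x | E (j, x)].
  by rewrite Ej; apply: bigcup_measurable => k _.
apply: (@space_uniform_continuity E A (e / 8)) => //.
- by rewrite divr_gt0.
- apply: scaled_ball_indic => // j; rewrite Ej.
  apply: (le_trans (measure_sigma_subadditive _ _ _ (@subset_refl _ _))) => //.
    by rewrite -Ej.
  apply: (@le_trans _ _ (\sum_(0 <= k <oo) (2 ^- k.+1)%:E * tau j)%E).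
    by apply: lee_nneseries => // k _; have [_ + _ _] := hAi k; exact.
  have [->|tauj] := eqVneq (tau j) +oo%E; first by rewrite leey.
  have tauf : tau j \is a fin_num by rewrite ge0_fin_numE// ltey.
  have tau0 : 0 <= fine (tau j) by exact: fine_ge0.
  rewrite -(fineK tauf); apply: le_trans (epsilon_trick0 xpredT tau0).
  apply: lee_nneseries => k _; rewrite -EFinM lee_fin; last by rewrite mulrC natrX.
  by rewrite mulr_ge0 ?invr_ge0 ?exprn_ge0.
- by move=> k u Au; exists k.
- by move=> k i ik; have [_ _ + _] := hAi k; exact.
- by move=> k; exists (Ai k).2; have [] := hAi k.
Qed.

End WeakStarNull.

(** * Growth of the fundamental function *)

Section Growth.
Variable R : realType.
Implicit Types (f psi w : R -> R) (t s c N : R) (gamma : \bar R).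

Definition slope w t := w t / t.

Record doubling_weight w N : Prop := DoublingWeight {
  doubling_ge4 : 4 <= N;
  weight_gt0 : forall t, 0 < t -> 0 < w t;
  weight_slope_ni : forall s t, 0 < s -> s <= t -> slope w t <= slope w s;
  weight_doubling : forall t, 0 < t -> 2 * w t <= w (N * t) }.

Lemma iterated_growth f (P : set R) c n t : 0 <= c ->
  (forall k, (k < n)%N -> P (2 ^+ k * t)) ->
  (forall s, P s -> c * f s <= f (2 * s)) -> c ^+ n * f t <= f (2 ^+ n * t).
Proof.
move=> c0 + h; elim: n => [|n IH] Pn; first by rewrite !expr0 !mul1r.
rewrite !exprS -!mulrA; apply: le_trans (h _ (Pn n _)) => //.
by rewrite ler_wpM2l// IH// => k kn; apply: Pn; exact: leqW.
Qed.

Lemma liminf0_gt1_doubling f : (forall t, 0 < t -> 0 < f t) -> liminf0_gt1 f ->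
  exists n a, 0 < a /\ forall t, 0 < t -> 2 ^+ n * t <= a -> 2 * f t <= f (2 ^+ n * t).
Proof.
move=> f_gt0 [c c1 [a /= a0 growth]]; have [n cn] := exprn_unbounded 2 c1.
exists n, a; split => // t t0 ta; apply: (@le_trans _ _ (c ^+ n * f t)).
  by rewrite ler_wpM2r// ltW// f_gt0.
apply: (@iterated_growth _ [set s | 0 < s < a]).
- by rewrite ltW// (lt_trans ltr01).
- move=> k kn /=; rewrite mulr_gt0 ?exprn_gt0//=; apply: lt_le_trans ta.
  by rewrite ltr_pM2r// ltr_eXn2l// ltr1n.
move=> s /= /andP[s0 sa]; have := growth s.
rewrite /ball/= sub0r normrN gtr0_norm// => /(_ sa s0).
by rewrite ltr_pdivlMr ?f_gt0// => /ltW.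
Qed.

Lemma liminfoo_gt1_doubling f : (forall t, 0 < t -> 0 < f t) -> liminfoo_gt1 f ->
  exists n b, 0 < b /\ forall t, b < t -> 2 * f t <= f (2 ^+ n * t).
Proof.
move=> f_gt0 [c c1 [b [_ growth]]]; have [n cn] := exprn_unbounded 2 c1.
have max_gt0 : 0 < Num.max b 1 by rewrite lt_max ltr01 orbT.
exists n, (Num.max b 1); split => // t bt; have t0 := lt_trans max_gt0 bt.
apply: (@le_trans _ _ (c ^+ n * f t)); first by rewrite ler_wpM2r// ltW// f_gt0.
apply: (@iterated_growth _ [set s | Num.max b 1 < s]).
- by rewrite ltW// (lt_trans ltr01).
- move=> k kn /=; apply: (lt_le_trans bt); rewrite ler_peMl ?exprn_ege1// ?ler1n//.
  exact: ltW.
move=> s /= bs; have s0 := lt_trans max_gt0 bs.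
move: bs; rewrite gt_max => /andP[/growth + _].
by rewrite ltr_pdivlMr ?f_gt0// => /ltW.
Qed.

Lemma doubling_at_some_scale f :
  (forall t, 0 < t -> 0 < f t) -> (forall s t, 0 < s -> s <= t -> f s <= f t) ->
  liminf0_gt1 f -> liminfoo_gt1 f ->
  exists2 N, 4 <= N & forall t, 0 < t -> 2 * f t <= f (N * t).
Proof.
move=> f_gt0 f_nd lim0 limoo.
have [m [a [a0 grow0]]] := liminf0_gt1_doubling f_gt0 lim0.
have [n [b [b0 growoo]]] := liminfoo_gt1_doubling f_gt0 limoo.
have m0 : 0 < 2 ^+ m :> R by rewrite exprn_gt0.
have n0 : 0 < 2 ^+ n :> R by rewrite exprn_gt0.
pose X : R := 2 ^+ n * (b + 1); have X0 : 0 < X by rewrite mulr_gt0// addr_gt0.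
have q0 : 0 < X * 2 ^+ m / a by rewrite divr_gt0// mulr_gt0.
pose N := 4 + 2 ^+ m + 2 ^+ n + X * 2 ^+ m / a.
exists N => [|t t0]; first by rewrite /N; lra.
have le_N c : c <= N -> c * t <= N * t by move=> cN; rewrite ler_wpM2r ?(ltW t0).
have [bt|tb] := ltP b t.
  apply: (le_trans (growoo t bt)); apply: f_nd; first by rewrite mulr_gt0.
  by apply: le_N; rewrite /N; lra.
have [ta|ta] := leP (2 ^+ m * t) a.
  apply: (le_trans (grow0 t t0 ta)); apply: f_nd; first by rewrite mulr_gt0.
  by apply: le_N; rewrite /N; lra.
apply: (@le_trans _ _ (2 * f (b + 1))); first by rewrite ler_wpM2l// f_nd//; lra.
apply: le_trans (growoo (b + 1) _) _; first by rewrite ltrDl.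
apply: f_nd => //; apply: (@le_trans _ _ (X * 2 ^+ m / a * t)).
  by rewrite mulrAC ler_pdivlMr// -(mulrA X); apply: ler_wpM2l; exact: ltW.
by apply: le_N; rewrite /N; lra.
Qed.

Lemma ex_doubling_weight f : (forall t, 0 < t -> 0 < f t) ->
  (forall s t, 0 < s -> s <= t -> f s <= f t) ->
  (forall s t, 0 < s -> s <= t -> slope f t <= slope f s) ->
  liminf0_gt1 f -> liminfoo_gt1 f -> exists N, doubling_weight f N.
Proof.
move=> f_gt0 f_nd f_slope lim0 limoo.
by have [N N4 doubling] := doubling_at_some_scale f_gt0 f_nd lim0 limoo; exists N.
Qed.

Lemma concave_slope_ni gamma psi s t :
  concave_on [set t | 0 <= t /\ (t%:E < gamma)%E] psi -> psi 0 = 0 ->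
  0 < s -> s <= t -> (t%:E < gamma)%E -> slope psi t <= slope psi s.
Proof.
move=> psi_concave psi0 s0 st tgamma; have t0 : 0 < t by exact: lt_le_trans st.
have gamma0 : (0%:E < gamma)%E by apply: lt_trans tgamma; rewrite lte_fin.
have st01 : 0 <= s / t <= 1 by rewrite divr_ge0 ?ler_pdivrMr ?mul1r ?(ltW s0) ?(ltW t0).
have := psi_concave t 0 (s / t) (conj (ltW t0) tgamma) (conj (lexx _) gamma0) st01.
by rewrite psi0 !mulr0 !addr0 divfK ?gt_eqF// /slope ler_pdivlMr// mulrAC -mulrA mulrC.
Qed.

Lemma nonzero_concave_gt0 gamma psi t :
  (forall t, 0 <= t -> (t%:E < gamma)%E -> 0 <= psi t) ->
  (exists t, [/\ 0 <= t, (t%:E < gamma)%E & psi t != 0]) ->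
  (forall s t, 0 <= s -> s <= t -> (t%:E < gamma)%E -> psi s <= psi t) ->
  concave_on [set t | 0 <= t /\ (t%:E < gamma)%E] psi -> psi 0 = 0 ->
  0 < t -> (t%:E < gamma)%E -> 0 < psi t.
Proof.
move=> psi_ge0 [t0 [t00 t0gamma psit0]] psi_nd psi_concave psi0 tp tgamma.
have t0p : 0 < t0.
  by rewrite lt_neqAle t00 andbT; apply: contraNneq psit0 => <-; rewrite psi0.
have psit0p : 0 < psi t0 by rewrite lt_neqAle eq_sym psit0 psi_ge0.
have [tt0|t0t] := leP t t0; last by apply: (lt_le_trans psit0p); apply: psi_nd => //; exact: ltW.
have := concave_slope_ni psi_concave psi0 tp tt0 t0gamma.
rewrite /slope ler_pdivlMr//; apply: lt_le_trans.
by rewrite mulr_gt0// divr_gt0.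
Qed.

Definition linear_extension psi t1 t := if t <= t1 then psi t else psi t1 * (t / t1).

Section LinearExtension.
Variables (psi : R -> R) (t1 : R).
Hypotheses (t1_gt0 : 0 < t1) (psi_gt0 : forall t, 0 < t -> t <= t1 -> 0 < psi t).
Local Notation ext := (linear_extension psi t1).
Let psit1 : 0 < psi t1. Proof. exact: psi_gt0. Qed.

Lemma linear_extension_gt0 t : 0 < t -> 0 < ext t.
Proof.
move=> t0; rewrite /linear_extension; case: ifPn => [|_]; first exact: psi_gt0.
by rewrite mulr_gt0// divr_gt0.
Qed.

Lemma linear_extension_nd s t :
  (forall s t, 0 < s -> s <= t -> t <= t1 -> psi s <= psi t) ->
  0 < s -> s <= t -> ext s <= ext t.
Proof.
move=> psi_nd s0 st; rewrite /linear_extension.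
have [ss|ss] := leP s t1; have [tt|tt] := leP t t1.
- exact: psi_nd.
- apply: (@le_trans _ _ (psi t1)); first exact: psi_nd.
  by rewrite ler_peMr ?(ltW psit1)// ler_pdivlMr// mul1r ltW.
- by have := lt_le_trans ss (le_trans st tt); rewrite ltxx.
- by rewrite ler_wpM2l ?(ltW psit1)// ler_wpM2r// invr_ge0 ltW.
Qed.

Lemma linear_extension_slope_ni s t :
  (forall s t, 0 < s -> s <= t -> t <= t1 -> slope psi t <= slope psi s) ->
  0 < s -> s <= t -> slope ext t <= slope ext s.
Proof.
move=> slope_ni s0 st; have t0 : 0 < t by exact: lt_le_trans st.
have lin r : 0 < r -> psi t1 * (r / t1) / r = psi t1 / t1.
  by move=> r0; field; rewrite !gt_eqF.
rewrite /slope /linear_extension; have [tt|tt] := leP t t1; have [ss|ss] := leP s t1.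
- exact: slope_ni.
- by have := lt_le_trans ss (le_trans st tt); rewrite ltxx.
- by rewrite lin//; exact: slope_ni.
- by rewrite !lin.
Qed.

Lemma linear_extension_itv t : 0 < t -> t <= 2 * t1 ->
  (t1 <= t -> slope psi t <= slope psi t1 /\ psi t1 <= psi t) ->
  psi t <= ext t <= 2 * psi t.
Proof.
move=> t0 t2 psit; rewrite /linear_extension; have [tt|/ltW tt] := leP t t1.
  by rewrite lexx/=; have := psi_gt0 t0 tt; lra.
have [slope_le nd] := psit tt; apply/andP; split.
  by move: slope_le; rewrite /slope ler_pdivrMr// mulrAC -mulrA.
apply: (@le_trans _ _ (psi t1 * 2)); first by rewrite ler_wpM2l ?(ltW psit1)// ler_pdivrMr.
by rewrite mulrC ler_wpM2l.
Qed.

Lemma linear_extension_liminf0 : liminf0_gt1 psi -> liminf0_gt1 ext.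
Proof.
move=> [c c1 psi_growth]; exists c => //; near=> t.
have t2 : 2 * t <= t1.
  rewrite -ler_pdivlMl// mulrC; near: t; apply: nbhs_right_le.
  by rewrite divr_gt0.
have t0 : 0 < t by near: t; exact: nbhs_right_gt.
rewrite /linear_extension t2 (_ : t <= t1); last by lra.
by near: t.
Unshelve. all: by end_near. Qed.

Lemma linear_extension_liminfoo : liminfoo_gt1 ext.
Proof.
exists (3 / 2); first by lra.
near=> t; have tt : t1 < t by near: t; apply: nbhs_pinfty_gt; exact: num_real.
have t0 : 0 < t by exact: lt_trans tt.
rewrite /linear_extension !leNgt tt (_ : t1 < 2 * t)/=; last by lra.
rewrite (_ : psi t1 * _ / _ = 2); first by lra.
by field; rewrite !gt_eqF.
Unshelve. all: by end_near. Qed.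

End LinearExtension.

(* On a finite interval [psi] is extended linearly past the midpoint; this changes it there by a
   factor at most [2] and makes the growth condition hold at infinity, too. *)
Lemma doubling_weight_majorant gamma psi : (0 < gamma)%E ->
  (forall t, 0 <= t -> (t%:E < gamma)%E -> 0 <= psi t) ->
  (exists t, [/\ 0 <= t, (t%:E < gamma)%E & psi t != 0]) ->
  (forall s t, 0 <= s -> s <= t -> (t%:E < gamma)%E -> psi s <= psi t) ->
  concave_on [set t | 0 <= t /\ (t%:E < gamma)%E] psi -> psi 0 = 0 ->
  (gamma = +oo%E /\ liminf0_gt1 psi /\ liminfoo_gt1 psi) \/
  ((gamma < +oo)%E /\ liminf0_gt1 psi) ->
  exists w N, doubling_weight w N /\
    forall t, 0 < t -> (t%:E < gamma)%E -> psi t <= w t <= 2 * psi t.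
Proof.
move=> gamma0 psi_ge0 psi_neq0 psi_nd psi_concave psi0.
have psi_gt0 t : 0 < t -> (t%:E < gamma)%E -> 0 < psi t.
  exact: (nonzero_concave_gt0 psi_ge0 psi_neq0 psi_nd psi_concave psi0).
have slope_ni s t : 0 < s -> s <= t -> (t%:E < gamma)%E -> slope psi t <= slope psi s.
  exact: (concave_slope_ni psi_concave psi0).
move=> [[gammaE [lim0 limoo]]|[gamma_fin lim0]].
  have lt_gamma t : (t%:E < gamma)%E by rewrite gammaE ltry.
  have [|||N dwN] := @ex_doubling_weight psi _ _ _ lim0 limoo.
  - by move=> t t0; exact: psi_gt0.
  - by move=> s t s0 st; apply: psi_nd => //; exact: ltW.
  - by move=> s t s0 st; exact: slope_ni.
  exists psi, N; split => // t t0 tgamma; have := psi_gt0 t t0 tgamma.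
  by rewrite lexx/=; lra.
have gammaE : gamma = (fine gamma)%:E by rewrite fineK// ge0_fin_numE// ltW.
move: gamma0 psi_nd psi_gt0 slope_ni {psi_ge0 psi_neq0 psi_concave gamma_fin}.
rewrite gammaE; set g := fine gamma; rewrite lte_fin => g0 psi_nd psi_gt0 slope_ni.
pose t1 := g / 2; have t1_gt0 : 0 < t1 by rewrite divr_gt0.
have le_t1 t : t <= t1 -> (t%:E < g%:E)%E by rewrite lte_fin /t1; lra.
have psi_gt0' t : 0 < t -> t <= t1 -> 0 < psi t by move=> t0 /le_t1; exact: psi_gt0.
have [|||||N dwN] := @ex_doubling_weight (linear_extension psi t1).
- by move=> t; exact: linear_extension_gt0.
- move=> s t; apply: linear_extension_nd => // {}s {}t s0 st /le_t1; apply: psi_nd => //.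
  exact: ltW.
- by move=> s t; apply: linear_extension_slope_ni => // {}s {}t s0 st /le_t1; exact: slope_ni.
- exact: linear_extension_liminf0.
- exact: linear_extension_liminfoo.
exists (linear_extension psi t1), N; split => // t t0 tg; apply: linear_extension_itv => //.
  by rewrite /t1 mulrC divfK// ltW.
by move=> tt; split; [exact: slope_ni|apply: psi_nd => //; exact: ltW].
Qed.

End Growth.

(** * Rearrangements *)

Lemma ex_exprz_itv (R : realType) (b v : R) : 1 < b -> 0 < v ->
  exists j : int, b ^ j < v <= b ^ (j + 1).
Proof.
move=> b1 v0; have b0 : 0 < b by exact: lt_trans b1.
have [m vm] := exprn_unbounded v^-1 b1; have [n vn] := exprn_unbounded v b1.
have bm : b ^ (- m%:Z) < v.
  by rewrite -exprnN -[ltRHS]invrK ltf_pV2 ?posrE ?invr_gt0 ?exprn_gt0.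
have ex_upper : exists n : nat, v <= b ^ (n%:Z - m%:Z).
  by exists (n + m)%N; rewrite PoszD addrK; exact: ltW.
case: (ex_minnP ex_upper) => -[|k] vk kmin.
  by move: vk; rewrite sub0r leNgt bm.
exists (k%:Z - m%:Z); rewrite addrAC -[X in X + 1]/(k%:Z) -PoszD addn1 vk andbT ltNge.
by apply/negP => /kmin; rewrite ltnn.
Qed.

Lemma ge0_le_integral_nonmeasurable d (T : measurableType d) (R : realType)
    (mu : {measure set T -> \bar R}) (D : set T) (f g : T -> \bar R) :
  (forall x, D x -> (0 <= f x)%E) -> (forall x, D x -> (f x <= g x)%E) ->
  (\int[mu]_(x in D) f x <= \int[mu]_(x in D) g x)%E.
Proof.
move=> f0 fg; rewrite !ge0_integralE//; last by move=> x Dx; exact: le_trans (f0 x Dx) (fg x Dx).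
apply: ereal_sup_le => _ [h /= hf <-]; exists h => // x.
apply: (le_trans (hf x)); rewrite /patch; case: ifPn => // /set_mem; exact: fg.
Qed.

Lemma lebesgue_measure_0oo (R : realType) (t : R) : 0 <= t ->
  lebesgue_measure [set s : R | 0 < s < t] = t%:E.
Proof.
rewrite -set_itvoo lebesgue_measure_itv/= lte_fin le_eqVlt.
by move=> /predU1P[<-|->]; rewrite ?ltxx// sube0.
Qed.

Lemma measurable_0oo (R : realType) (t : R) : measurable [set s : R | 0 < s < t].
Proof. by rewrite -set_itvoo. Qed.

Section DoublingWeight.
Variables (R : realType) (w : R -> R) (N : R).
Hypothesis dw : doubling_weight w N.
Let N4 : 4 <= N := doubling_ge4 dw.
Let N0 : 0 < N. Proof. exact: lt_le_trans N4. Qed.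

Lemma slope_gt0 t : 0 < t -> 0 < slope w t.
Proof. by move=> t0; rewrite divr_gt0// (weight_gt0 dw). Qed.

Lemma slope_le_doubling t : 0 < t -> slope w t <= N / 2 * slope w (N * t).
Proof.
move=> t0; have := weight_doubling dw t0; rewrite /slope ler_pdivrMr// => dbl.
have -> : N / 2 * (w (N * t) / (N * t)) * t = w (N * t) / 2 by field; rewrite !gt_eqF.
by rewrite ler_pdivlMr// mulrC.
Qed.

Lemma slope_iter t m : 0 < t -> slope w t <= (N / 2) ^+ m * slope w (N ^+ m * t).
Proof.
move=> t0; elim: m => [|m IH]; first by rewrite !expr0 !mul1r.
have Nt0 : 0 < N ^+ m * t by rewrite mulr_gt0// exprn_gt0.
apply: (le_trans IH); rewrite exprSr -mulrA ler_wpM2l ?exprn_ge0 ?divr_ge0 ?(ltW N0)//.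
by rewrite [N ^+ m.+1]exprS -[N * _ * t]mulrA; exact: slope_le_doubling.
Qed.

Lemma slope_half t : 0 < t -> slope w (t / 2) <= N * slope w t.
Proof.
move=> t0; have t20 : 0 < t / 2 by rewrite divr_gt0.
apply: (le_trans (slope_le_doubling t20)); apply: ler_pM.
- by rewrite divr_ge0// ltW.
- by apply/ltW/slope_gt0; rewrite mulr_gt0.
- by rewrite ler_pdivrMr// ler_peMr ?(ltW N0)// ler1n.
- by apply: (weight_slope_ni dw) => //; rewrite mulrCA ler_peMr ?(ltW t0)//; move: N4; lra.
Qed.

Lemma weight_iter t k : 0 < t -> w (t / N ^+ k) <= 2 ^- k * w t.
Proof.
move=> t0; elim: k => [|k IH]; first by rewrite !expr0 invr1 mulr1 mul1r.
have tN : 0 < t / N ^+ k.+1 by rewrite divr_gt0// exprn_gt0.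
have := weight_doubling dw tN.
have -> : N * (t / N ^+ k.+1) = t / N ^+ k by rewrite exprS; field; rewrite ?expf_neq0// gt_eqF.
by move=> h; rewrite [2 ^+ k.+1]exprS invfM -mulrA ler_pdivlMl//; exact: le_trans IH.
Qed.

Lemma ex_geometric_itv s t : 0 < s < t -> exists k : nat, t / N ^+ k.+1 <= s < t / N ^+ k.
Proof.
move=> /andP[s0 st]; have N1 : 1 < N by apply: lt_le_trans N4; rewrite ltr1n.
have [j /andP[]] := ex_exprz_itv N1 (divr_gt0 (lt_trans s0 st) s0).
case: j => k; last first.
  rewrite NegzE -addn1 PoszD opprD subrK -exprnN => _; rewrite leNgt => /negP[].
  rewrite (@le_lt_trans _ _ 1)//; last by rewrite ltr_pdivlMr// mul1r.
  by rewrite invf_le1 ?exprn_gt0// exprn_ege1// ltW.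
rewrite -PoszD addn1 -!exprnP ltr_pdivlMr// ler_pdivrMr// => ks sk.
by exists k; rewrite ler_pdivrMr ?exprn_gt0// ltr_pdivlMr ?exprn_gt0// mulrC sk mulrC.
Qed.

(* On [t / N ^+ n.+1, t / N ^+ n[ the slope is at most its value at the left end; the resulting
   series of integrals is dominated by a geometric one. *)
Lemma integral_slope_le k t : 0 <= k -> 0 < t ->
  (\int[lebesgue_measure]_(s in [set s : R | (0 < s < t)%R]) (k * slope w s)%:E
    <= (N * k * w t)%:E)%E.
Proof.
move=> k0 t0; pose c n := k * slope w (t / N ^+ n.+1).
pose A n := [set s : R | 0 < s < t / N ^+ n].
have tN n : 0 < t / N ^+ n by rewrite divr_gt0// exprn_gt0.
have c0 n : 0 <= c n by rewrite mulr_ge0// ltW// slope_gt0.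
have term_ge0 n s : (0 <= (c n)%:E * (\1_(A n) s)%:E)%E.
  by rewrite -EFinM lee_fin mulr_ge0// indicE.
have mA n : measurable_fun [set s : R | 0 < s < t] (fun s => (\1_(A n) s : R)%:E).
  by apply/measurable_EFinP/measurable_indic; exact: measurable_0oo.
apply: (@le_trans _ _ (\int[lebesgue_measure]_(s in [set s : R | (0 < s < t)%R])
    (\sum_(n <oo) (c n)%:E * (\1_(A n) s)%:E))%E).
  apply: ge0_le_integral_nonmeasurable => s /= st; have /andP[s0 _] := st.
    by rewrite lee_fin mulr_ge0// ltW// slope_gt0.
  have [n /andP[ns sn]] := ex_geometric_itv st.
  apply: (@le_trans _ _ ((c n)%:E * (\1_(A n) s)%:E)%E).
    rewrite indicE mem_set ?mule1; last by rewrite /A/= s0.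
    by rewrite lee_fin ler_wpM2l// (weight_slope_ni dw).
  apply: le_trans (nneseries_lim_ge n.+1 (fun m _ _ => term_ge0 m s)).
  by rewrite big_nat_recr//= leeDr// sume_ge0.
rewrite integral_nneseries//; first last.
- by move=> n; apply: emeasurable_funM => //; exact: mA.
- exact: measurable_0oo.
have Nkw : 0 <= N * k * w t by rewrite !mulr_ge0 ?(ltW N0)// ltW// (weight_gt0 dw).
apply: le_trans (epsilon_trick0 xpredT Nkw); apply: lee_nneseries => [n _ _|n _].
  by apply: integral_ge0.
rewrite ge0_integralZl//; [|exact: measurable_0oo|exact: mA|by rewrite lee_fin].
rewrite integral_indic; [|exact: measurable_0oo|exact: measurable_0oo].
apply: (@le_trans _ _ ((c n)%:E * (t / N ^+ n)%:E)%E).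
  apply: lee_wpmul2l; first by rewrite lee_fin.
  rewrite -(lebesgue_measure_0oo (ltW (tN n))); apply: le_measure; rewrite ?inE.
  - by apply: measurableI; exact: measurable_0oo.
  - exact: measurable_0oo.
  - exact: subIsetl.
rewrite -EFinM lee_fin /c /slope.
rewrite (_ : _ * (t / N ^+ n) = N * k * w (t / N ^+ n.+1)); last first.
  by rewrite exprS; field; rewrite ?expf_neq0 ?gt_eqF.
rewrite -[leRHS]mulrA ler_wpM2l ?mulr_ge0 ?(ltW N0)// natrX [leRHS]mulrC.
exact: weight_iter.
Qed.

End DoublingWeight.

Section Rearrangement.
Context {R : realType} {d : measure_display} {T : measurableType d}.
Variables (mu : {measure set T -> \bar R}) (psi w : R -> R) (N : R).
Implicit Types (f g : T -> R) (a k l s t : R).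

Lemma drearr_ge0 f t : (0 <= drearr mu f t)%E.
Proof. by apply: le_ereal_inf_tmp => _ [s [s0 _] <-]; rewrite lee_fin. Qed.

Lemma drearr_ni f s t : s <= t -> (drearr mu f t <= drearr mu f s)%E.
Proof.
move=> st; apply: ereal_inf_le_tmp => _ [a [a0 fa] <-]; exists a => //; split => //.
by apply: (le_trans fa); rewrite lee_fin.
Qed.

Lemma le_measure_norm_gt f a b : measurable_fun setT f -> a <= b ->
  (mu [set x | (b < `|f x|)%R] <= mu [set x | (a < `|f x|)%R])%E.
Proof.
move=> mf ab; apply: le_measure; rewrite ?inE; [exact: measurable_norm_gt..|].
by move=> x /=; exact: le_lt_trans.
Qed.

(* Distributional form of [drearr mu g t <= k * slope w t]. *)
Definition rearr_le k g := forall t a, 0 < t -> k * slope w t < a ->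
  (mu [set x | (a < `|g x|)%R] <= t%:E)%E.

Lemma drearr_le_slope k f t : 0 <= k * slope w t -> 0 < t -> rearr_le k f ->
  (drearr mu f t <= (k * slope w t)%:E)%E.
Proof.
move=> kw0 t0 fk; apply/lee_addgt0Pr => e e0; apply: ereal_inf_lbound.
exists (k * slope w t + e) => //; split; first by apply: addr_ge0 (ltW e0).
by apply: fk => //; rewrite ltrDl.
Qed.

Lemma rearr_leZ k l g : l != 0 -> rearr_le k g -> rearr_le (`|l| * k) (l *: g).
Proof.
rewrite -normr_gt0 => l0 gk t a t0; rewrite -mulrA -ltr_pdivlMl// => /(gk _ _ t0).
rewrite (_ : [set x | a < _] = [set x | `|l|^-1 * a < `|g x|])//.
by apply/funext => x /=; rewrite normrM ltr_pdivrMl.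
Qed.

Lemma rearr_le_null f : measurable_fun setT f -> mu [set x | f x != 0] = 0%E -> rearr_le 0 f.
Proof.
move=> mf f0 t a t0; rewrite mul0r => a0.
apply: le_trans (le_measure_norm_gt mf (ltW a0)) _.
under eq_set do rewrite normr_gt0.
by rewrite f0 lee_fin ltW.
Qed.

Hypotheses (mu_gt0 : (0 < mu setT)%E) (dw : doubling_weight w N)
  (psi_w : forall t, 0 < t -> (t%:E < mu setT)%E -> psi t <= w t <= 2 * psi t).
Let N0 : 0 < N. Proof. exact: lt_le_trans (doubling_ge4 dw). Qed.
Let w_gt0 := weight_gt0 dw.
Let psi_gt0 t : 0 < t -> (t%:E < mu setT)%E -> 0 < psi t.
Proof. by move=> t0 tmu; have /andP[_] := psi_w t0 tmu; have := w_gt0 t0; lra. Qed.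

Lemma rearr_leD k l f g : 0 <= k -> 0 <= l -> measurable_fun setT f -> measurable_fun setT g ->
  rearr_le k f -> rearr_le l g -> rearr_le (2 * N * (k + l)) (f + g).
Proof.
move=> k0 l0 mf mg fk gl t a t0 ha; have t20 : 0 < t / 2 by rewrite divr_gt0.
have slope_le c : 0 <= c -> c <= k + l -> c * slope w (t / 2) < a / 2.
  move=> c0 ckl; rewrite ltr_pdivlMr//; apply: le_lt_trans ha.
  have := slope_half dw t0; have := slope_gt0 dw t20; have := slope_gt0 dw t0.
  move: (slope w t) (slope w (t / 2)) => p q p0 q0 qp.
  rewrite (_ : 2 * N * (k + l) * p = (k + l) * (N * p) * 2); last by ring.
  by rewrite ler_wpM2r// ler_pM// ltW.
have fa := fk _ _ t20 (slope_le k k0 _); have ga := gl _ _ t20 (slope_le l l0 _).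
apply: (@le_trans _ _ (mu ([set x | (a / 2 < `|f x|)%R] `|` [set x | (a / 2 < `|g x|)%R]))).
  apply: le_measure; rewrite ?inE.
  - by apply: measurable_norm_gt; exact: measurable_funD.
  - by apply: measurableU; exact: measurable_norm_gt.
  - move=> x /= ax; apply: contrapT => /not_orP[/negP + /negP]; rewrite -!leNgt.
    by have := ler_normD (f x) (g x); move: ax; rewrite fctE; lra.
apply: (le_trans (measureU2 _ _ _)); [exact: measurable_norm_gt..|].
rewrite [t](splitr t) EFinD; apply: leeD; [apply: fa|apply: ga]; rewrite ?lerDl// lerDr//.
Qed.

Lemma Mnorm_rearr_le k f : measurable_fun setT f -> (Mnorm mu psi f <= k%:E)%E -> rearr_le k f.
Proof.
move=> mf fk t a t0 ha.
have [tmu|mut] := ltP t%:E (mu setT); last first.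
  by apply: le_trans mut; apply: le_measure; rewrite ?inE//; exact: measurable_norm_gt.
have /andP[psi_le _] := psi_w t0 tmu; have psit := psi_gt0 t0 tmu.
have drearr_le : ((psi t)^-1%:E * (drearr mu f t * t%:E) <= k%:E)%E.
  apply: le_trans fk; apply: (@le_trans _ _ ((psi t)^-1%:E *
    \int[lebesgue_measure]_(s in [set s : R | (0 < s < t)%R]) drearr mu f s)%E); last first.
    by apply: ereal_sup_ubound; exists t.
  apply: lee_wpmul2l; first by rewrite lee_fin invr_ge0 ltW.
  rewrite -(lebesgue_measure_0oo (ltW t0)) -integral_cst; last exact: measurable_0oo.
  apply: ge0_le_integral_nonmeasurable => s /=; first by rewrite drearr_ge0.
  by move=> /andP[_ /ltW]; exact: drearr_ni.
have : (drearr mu f t < a%:E)%E; last first.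
  move=> /ereal_inf_lt[_ [s [s0 hs] <-]]; rewrite lte_fin => /ltW sa.
  exact: le_trans (le_measure_norm_gt mf sa) hs.
case: (drearr mu f t) (drearr_ge0 f t) drearr_le => [r| |//].
  rewrite -!EFinM !lee_fin lte_fin ler_pdivrMl// mulrC => r0 rt.
  have k0 : 0 <= k by rewrite -(pmulr_rge0 _ psit); apply: le_trans rt; rewrite mulr_ge0// ltW.
  apply: le_lt_trans ha; rewrite /slope mulrA ler_pdivlMr// mulrC.
  by apply: (le_trans rt); rewrite mulrC ler_wpM2l.
by move=> _; rewrite gt0_mulye// gt0_muley ?lte_fin ?invr_gt0.
Qed.

Lemma rearr_le_Mnorm k f : 0 <= k -> rearr_le k f -> (Mnorm mu psi f <= (2 * N * k)%:E)%E.
Proof.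
move=> k0 fk; apply: ge_ereal_sup => _ [t [t0 tmu] <-].
have /andP[_ w_le] := psi_w t0 tmu; have psit := psi_gt0 t0 tmu.
apply: (@le_trans _ _ ((psi t)^-1%:E * (N * k * w t)%:E)%E).
  apply: lee_wpmul2l; first by rewrite lee_fin invr_ge0 ltW.
  apply: le_trans (integral_slope_le dw k0 t0).
  apply: ge0_le_integral_nonmeasurable => s /= => [_|/andP[s0 _]]; first exact: drearr_ge0.
  by apply: drearr_le_slope => //; rewrite mulr_ge0// ltW// (slope_gt0 dw).
rewrite -EFinM lee_fin ler_pdivrMl//.
have : N * k * w t <= N * k * (2 * psi t) by rewrite ler_wpM2l// mulr_ge0// ltW.
lra.
Qed.

Lemma Mnorm_ge0 f : (0 <= Mnorm mu psi f)%E.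
Proof.
have [t t0 tmu] : exists2 t : R, 0 < t & (t%:E < mu setT)%E.
  have [->|muoo] := eqVneq (mu setT) +oo%E; first by exists 1 => //; rewrite ltry.
  have mufin : mu setT \is a fin_num by rewrite ge0_fin_numE// ltey.
  have fine_gt0 : 0 < fine (mu setT) by rewrite fine_gt0// mu_gt0 ltey.
  exists (fine (mu setT) / 2); first by rewrite divr_gt0.
  by rewrite -[ltRHS](fineK mufin) lte_fin gtr_pMr// invf_lt1// ltr1n.
apply: (@le_trans _ _ (((psi t)^-1)%:E *
  (\int[lebesgue_measure]_(s in [set s : R | (0 < s < t)%R]) drearr mu f s))%E).
  rewrite mule_ge0 ?lee_fin ?invr_ge0 ?(ltW (psi_gt0 _ _))//.
  by apply: integral_ge0 => s _; exact: drearr_ge0.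
by apply: ereal_sup_ubound; exists t.
Qed.

Lemma fine_Mnorm_ge0 f : 0 <= fine (Mnorm mu psi f).
Proof. by rewrite fine_ge0 ?Mnorm_ge0. Qed.

Lemma rearr_le_fine_Mnorm k f : 0 <= k -> rearr_le k f -> fine (Mnorm mu psi f) <= 2 * N * k.
Proof.
move=> k0 /(rearr_le_Mnorm k0) fk; rewrite -lee_fin fineK// ge0_fin_numE ?Mnorm_ge0//.
exact: le_lt_trans fk (ltry _).
Qed.

Lemma MspaceP f : Mspace mu psi f <->
  measurable_fun setT f /\ exists2 k, 0 <= k & rearr_le k f.
Proof.
split=> [[mf foo]|[mf [k k0 /(rearr_le_Mnorm k0) fk]]]; split => //; last first.
  exact: le_lt_trans fk (ltry _).
have ffin : Mnorm mu psi f \is a fin_num by rewrite ge0_fin_numE ?Mnorm_ge0.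
exists (fine (Mnorm mu psi f)); first exact: fine_Mnorm_ge0.
by apply: Mnorm_rearr_le => //; rewrite fineK.
Qed.

Lemma rearr_le0 : rearr_le 0 (0 : T -> R).
Proof.
apply: rearr_le_null; first exact: (measurable_cst (0 : R)).
by rewrite (_ : [set x | _] = set0) ?measure0//; apply/seteqP; split => x //=; rewrite eqxx.
Qed.

Lemma Mspace_subspace : linear_subspace (Mspace mu psi).
Proof.
split.
  apply/MspaceP; split; last by exists 0 => //; exact: rearr_le0.
  exact: (measurable_cst (0 : R)).
move=> a f g /MspaceP[mf [k k0 fk]] /MspaceP[mg [l l0 gl]]; apply/MspaceP.
have maf : measurable_fun setT (a *: f) by exact: measurable_funM.
split; first exact: measurable_funD.
have [a0|a0] := eqVneq a 0.
  by rewrite a0 scale0r add0r; exists l.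
exists (2 * N * (`|a| * k + l)); first by rewrite !mulr_ge0 ?addr_ge0 ?mulr_ge0// ltW.
by apply: rearr_leD => //; [exact: mulr_ge0|exact: rearr_leZ].
Qed.

End Rearrangement.

(** * Synthesis of functions from their slices *)

Section FoldInt.
Variable R : realType.
Implicit Types (f V : int -> R) (J : int).

Definition fold_int f (k : nat) : R := f (Posz k) + f (Negz k).

Lemma sum_fold_int_telescope f V n : (forall j, f j <= V (j + 1) - V j) ->
  \sum_(k < n) fold_int f k <= V n%:Z - V (- n%:Z).
Proof.
move=> fV; elim: n => [|n IH]; first by rewrite big_ord0 oppr0 subrr.
rewrite big_ord_recr/= /fold_int; have := fV (Posz n); have := fV (Negz n).
have -> : Negz n + 1 = - n%:Z by rewrite NegzE -addn1 PoszD opprD subrK.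
have -> : Posz n + 1 = n.+1%:Z by rewrite -addn1 PoszD.
rewrite NegzE; lra.
Qed.

Lemma sum_low_powers (b : R) J n : 2 <= b ->
  \sum_(k < n) fold_int (fun j => if j <= J then b ^ j else 0) k <= b ^ (J + 1).
Proof.
move=> b2; have b0 : 0 < b by exact: lt_le_trans b2.
pose V (j : int) := b ^ (Num.min j (J + 1)).
apply: (@le_trans _ _ (V n%:Z - V (- n%:Z))).
  apply: sum_fold_int_telescope => j; rewrite /V; case: ifPn => [jJ|].
    rewrite !min_l ?lerD2r//; last by rewrite (le_trans jJ)// lerDl.
    rewrite expfzDr ?gt_eqF// expr1z; have := exprz_gt0 j b0; nra.
  rewrite -ltNge => Jj; rewrite !min_r ?subrr ?lerD2r// ?(ltW Jj)//.
  by rewrite lezD1.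
apply: (@le_trans _ _ (V n%:Z)); first by rewrite gerBl ltW// exprz_gt0.
rewrite /V ler_weXz2l//; first by rewrite (le_trans _ b2)// ler1n.
by rewrite ge_min lexx orbT.
Qed.

Lemma sum_high_powers J n :
  \sum_(k < n) fold_int (fun j => if j <= J then 0 else 2 ^ (- j)) k <= 2 ^ (- J).
Proof.
pose V (j : int) : R := - 2 ^ (1 - Num.max j (J + 1)).
apply: (@le_trans _ _ (V n%:Z - V (- n%:Z))).
  apply: sum_fold_int_telescope => j; rewrite /V; case: ifPn => [jJ|].
    by rewrite !max_r ?subrr ?lerD2r// (le_trans jJ)// lerDl.
  rewrite -ltNge => Jj; rewrite !max_l ?lerD2r ?(ltW Jj) ?lezD1//.
  have -> : 1 - (j + 1) = - j :> int by ring.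
  have -> : (2 : R) ^ (1 - j) = 2 * 2 ^ (- j) by rewrite expfzDr// expr1z.
  lra.
apply: (@le_trans _ _ (- V (- n%:Z))); first by rewrite gerDr oppr_le0 exprz_ge0.
rewrite /V opprK ler_weXz2l ?ler1n//.
rewrite lerBlDr -lerBlDl opprK addrC.
by rewrite le_max lexx orbT.
Qed.

Definition fold_index (j : int) : nat := match j with Posz k => k | Negz k => k end.

Lemma fold_int_single f j0 k : (forall j, j != j0 -> f j = 0) ->
  fold_int f k = (k == fold_index j0)%:R * f j0.
Proof.
move=> f0; rewrite /fold_int; case: j0 f0 => m f0 /=; have [->|km] := eqVneq k m.
- by rewrite (f0 (Negz m))// mul1r addr0.
- by rewrite mul0r !f0 ?addr0// eqz_nat.
- by rewrite (f0 (Posz m))// mul1r add0r.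
- by rewrite mul0r !f0 ?addr0.
Qed.

Lemma sum_fold_int_single f j0 n : (forall j, j != j0 -> f j = 0) ->
  (fold_index j0 < n)%N -> \sum_(k < n) fold_int f k = f j0.
Proof.
move=> f0 j0n; rewrite (bigD1 (Ordinal j0n))//= (fold_int_single _ f0) eqxx mul1r.
rewrite big1 ?addr0// => k kj0; rewrite (fold_int_single _ f0).
by rewrite (_ : (val k == _) = false) ?mul0r//; apply/negbTE.
Qed.

End FoldInt.

Section Synthesis.
Context {R : realType} {d : measure_display} {T : measurableType d}.
Variables (mu : {measure set T -> \bar R}) (w : R -> R) (N : R).
Hypothesis dw : doubling_weight w N.
Local Notation b := (N / 2).
Implicit Types (y z : int * T -> R) (f : T -> R) (c e s t : R) (J K j : int).

(* The largest measure of [|f| > b ^ j] for [f] with rearrangement at most [slope w]. *)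
Definition level j : \bar R :=
  ereal_sup [set t%:E | t in [set t : R | t = 0 \/ 0 < t /\ b ^ j <= slope w t]].

Local Notation B := (scaled_ball mu level).
Local Notation Y := (scaled_space mu level).

Let N4 : 4 <= N := doubling_ge4 dw.
Let b2 : 2 <= b. Proof. by rewrite ler_pdivlMr// -natrM. Qed.
Let b0 : 0 < b. Proof. exact: lt_le_trans b2. Qed.
Let b1 : 1 < b. Proof. by apply: lt_le_trans b2; rewrite ltr1n. Qed.
Let bj j : 0 < b ^ j. Proof. exact: exprz_gt0. Qed.
Let N0 : 0 < N. Proof. exact: lt_le_trans N4. Qed.

Lemma level_ge0 j : (0 <= level j)%E.
Proof. by apply: ereal_sup_ubound; exists 0 => //; left. Qed.

Lemma level_decay s K (m : nat) : 0 < s -> slope w s < b ^ K ->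
  (level (K + m%:Z) <= (s / N ^+ m)%:E)%E.
Proof.
move=> s0 sK; apply: ge_ereal_sup => _ [t [->|[t0 ht]] <-]; rewrite lee_fin.
  by rewrite divr_ge0 ?exprn_ge0 ?ltW.
rewrite ler_pdivlMr ?exprn_gt0// mulrC leNgt; apply/negP => sNt.
have := weight_slope_ni dw s0 (ltW sNt); rewrite leNgt => /negP; apply.
apply: (lt_le_trans sK); move: ht; rewrite expfzDr ?gt_eqF// -exprnP => ht.
by have := le_trans ht (slope_iter dw m t0); rewrite [b ^ K * _]mulrC ler_pM2l// exprn_gt0.
Qed.

Lemma measure_norm_gt_level f j : measurable_fun setT f -> rearr_le mu w 1 f ->
  (mu [set x | (b ^ j < `|f x|)%R] <= level j)%E.
Proof.
move=> mf f1; have [->|ly] := eqVneq (level j) +oo%E; first by rewrite leey.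
have lf : level j \is a fin_num by rewrite ge0_fin_numE ?level_ge0// ltey.
apply/lee_addgt0Pr => e e0; rewrite -(fineK lf) -EFinD.
have l0 : 0 <= fine (level j) by rewrite fine_ge0// level_ge0.
apply: f1; first by rewrite ltr_wpDl.
rewrite mul1r ltNge; apply/negP => h.
have : ((fine (level j) + e)%:E <= level j)%E.
  by apply: ereal_sup_ubound; exists (fine (level j) + e) => //; right; rewrite ltr_wpDl.
by rewrite -{2}(fineK lf) lee_fin gerDl leNgt e0.
Qed.

Lemma ex_exprz_above_slope s : 0 < s ->
  exists K, slope w s < b ^ K /\ b ^ (K + 1) <= b ^+ 3 * slope w s.
Proof.
move=> s0; have [j /andP[j1 j2]] := ex_exprz_itv b1 (slope_gt0 dw s0).
exists (j + 1 + 1); split.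
  by apply: (le_lt_trans j2); rewrite [ltRHS]expfzDr ?gt_eqF// expr1z ltr_pMr.
have -> : b ^ (j + 1 + 1 + 1) = b ^+ 3 * b ^ j.
  by rewrite !expfzDr ?gt_eqF// !expr1z; move: (b ^ j) => p; ring.
by rewrite ler_wpM2l ?exprn_ge0 ?(ltW b0)// ltW.
Qed.

Definition synth_term y (k : nat) x : R := fold_int (fun j => b ^ (j + 1) * y (j, x)) k.

Definition abs_synth y x : \bar R := (\sum_(k <oo) (synth_term (Num.norm \o y) k x)%:E)%E.

Definition synth_dom y : set T := [set x | (abs_synth y x < +oo)%E].

(* The sum of [b ^ (j + 1) * y_j] over all integers [j], and [0] where it does not converge
   absolutely. *)
Definition synth y (x : T) : R := \1_(synth_dom y) x * limn (series (synth_term y ^~ x)).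

Lemma abs_synth_term_ge0 y k x : 0 <= synth_term (Num.norm \o y) k x.
Proof. by rewrite /synth_term /fold_int/= addr_ge0// mulr_ge0// ltW. Qed.

Lemma synth_term_le y k x : `|synth_term y k x| <= synth_term (Num.norm \o y) k x.
Proof.
apply: (le_trans (ler_normD _ _)); rewrite !normrM.
by rewrite (gtr0_norm (bj _)) (gtr0_norm (bj (Negz k + 1))).
Qed.

Lemma abs_synth_ge0 y x : (0 <= abs_synth y x)%E.
Proof. by apply: nneseries_ge0 => k _ _; rewrite lee_fin abs_synth_term_ge0. Qed.

Lemma abs_synth_le_ub y x (c : \bar R) :
  (forall n, ((\sum_(k < n) synth_term (Num.norm \o y) k x)%:E <= c)%E) -> (abs_synth y x <= c)%E.
Proof.
move=> yc; apply: lime_le; last by apply: nearW => n; rewrite big_mkord sumEFin.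
by apply: is_cvg_nneseries => k _ _; rewrite lee_fin abs_synth_term_ge0.
Qed.

Lemma synth_cvg y x : synth_dom y x -> cvgn (series (synth_term y ^~ x)).
Proof.
move=> yx; apply: normed_cvg; apply: (series_le_cvg _ _ (synth_term_le y ^~ x)).
- by move=> n; exact: normr_ge0.
- by move=> n; exact: abs_synth_term_ge0.
- by apply: nnseries_is_cvg => // k; exact: abs_synth_term_ge0.
Qed.

Lemma norm_synth_le y x : (`|synth y x|%:E <= abs_synth y x)%E.
Proof.
rewrite /synth indicE; have [/set_mem yx|yx] := boolP (x \in _); last first.
  by rewrite mul0r normr0 abs_synth_ge0.
rewrite mul1r; have /cvg_norm sc := synth_cvg yx.
have yfin : abs_synth y x \is a fin_num by rewrite ge0_fin_numE// abs_synth_ge0.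
rewrite -(fineK yfin) lee_fin; apply: (cvgr_to_le sc); apply: nearW => n.
rewrite -lee_fin fineK// /series/=.
apply: (@le_trans _ _ (\sum_(0 <= k < n) (synth_term (Num.norm \o y) k x)%:E)%E).
  rewrite sumEFin lee_fin; apply: (le_trans (ler_norm_sum _ _ _)).
  by apply: ler_sum => k _; exact: synth_term_le.
by apply: nneseries_lim_ge => k _ _; rewrite lee_fin abs_synth_term_ge0.
Qed.

Lemma measurable_synth_term y k : slice_measurable y -> measurable_fun setT (synth_term y k).
Proof. by move=> my; apply: measurable_funD; apply: measurable_funM. Qed.

Lemma slice_measurable_norm y : slice_measurable y -> slice_measurable (Num.norm \o y).
Proof. by move=> my j; exact: measurableT_comp. Qed.

Lemma measurable_abs_synth y : slice_measurable y -> measurable_fun setT (abs_synth y).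
Proof.
move=> my; apply: ge0_emeasurable_sum => k.
  by move=> x _ _; rewrite lee_fin abs_synth_term_ge0.
move=> _; apply/measurable_EFinP; apply: measurable_synth_term.
exact: slice_measurable_norm.
Qed.

Lemma measurable_synth_dom y : slice_measurable y -> measurable (synth_dom y).
Proof.
move=> my; rewrite -(setTI (synth_dom y)); apply: emeasurable_fun_infty_o => //.
exact: measurable_abs_synth.
Qed.

Lemma measurable_synth y : slice_measurable y -> measurable_fun setT (synth y).
Proof.
move=> my; apply: (@measurable_fun_cvg _ _ _ setT
  (fun n x => \1_(synth_dom y) x * series (synth_term y ^~ x) n)).
  move=> n; apply: measurable_funM; first exact/measurable_indic/measurable_synth_dom.
  by apply: measurable_sum => k; exact: measurable_synth_term.
move=> x _; rewrite /synth indicE; have [/set_mem yx|yx] := boolP (x \in _).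
  by rewrite mul1r; under eq_fun do rewrite mul1r; exact: synth_cvg.
by rewrite mul0r; under eq_fun do rewrite mul0r; exact: cvg_cst.
Qed.

Lemma synth_linear a y z x : synth_dom y x -> synth_dom z x -> synth_dom (a *: y + z) x ->
  synth (a *: y + z) x = a * synth y x + synth z x.
Proof.
move=> yx zx ayzx; rewrite /synth !indicE !mem_set// !mul1r.
have -> : series (synth_term (a *: y + z) ^~ x) =
    (fun n => a * series (synth_term y ^~ x) n + series (synth_term z ^~ x) n).
  apply/funext => n; rewrite /series/= mulr_sumr -big_split/=.
  by apply: eq_bigr => k _; rewrite /synth_term /fold_int !fctE /GRing.scale/=; ring.
apply/cvg_lim => //; apply: cvgD; last exact: synth_cvg.
by apply: cvgM; [exact: cvg_cst|exact: synth_cvg].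
Qed.

Lemma synth_single y x j0 : (forall j, j != j0 -> y (j, x) = 0) ->
  synth y x = b ^ (j0 + 1) * y (j0, x).
Proof.
move=> y0; have f0 j : j != j0 -> b ^ (j + 1) * y (j, x) = 0 by move=> /y0 ->; rewrite mulr0.
have g0 j : j != j0 -> b ^ (j + 1) * `|y (j, x)| = 0 by move=> /y0 ->; rewrite normr0 mulr0.
have yx : synth_dom y x.
  apply: le_lt_trans (ltry (b ^ (j0 + 1) * `|y (j0, x)|)).
  apply: abs_synth_le_ub => n; rewrite lee_fin.
  pose m := maxn n (fold_index j0).+1.
  have mj0 : (fold_index j0 < m)%N by rewrite leq_max leqnn orbT.
  rewrite -(sum_fold_int_single g0 mj0).
  rewrite -(big_mkord xpredT (synth_term (Num.norm \o y) ^~ x)) -[leRHS](big_mkord xpredT).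
  apply: (@nondecreasing_series _ (synth_term (Num.norm \o y) ^~ x) xpredT 0 _ n m).
    by move=> k _ _; exact: abs_synth_term_ge0.
  exact: leq_maxl.
rewrite /synth indicE mem_set// mul1r; apply/cvg_lim => //.
apply: cvg_near_cst; exists (fold_index j0).+1 => // n /= j0n.
by rewrite /series/= big_mkord; exact: (sum_fold_int_single f0 j0n).
Qed.

Definition high_part J y : int * T -> R := fun u => if u.1 <= J then 0 else y u.

Lemma high_part_measurable J y : slice_measurable y -> slice_measurable (high_part J y).
Proof.
by move=> my j; rewrite /high_part/=; case: (j <= J) => //; exact: (measurable_cst (0 : R)).
Qed.

Lemma abs_synth_le_high J y e x : 0 <= e -> (forall u, `|y u| <= e) ->
  (abs_synth y x <= (e * b ^ (J + 2))%:E + abs_synth (high_part J y) x)%E.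
Proof.
move=> e0 ye; apply: abs_synth_le_ub => n.
have split_term j : b ^ (j + 1) * `|y (j, x)| <=
    e * b * (if j <= J then b ^ j else 0) + b ^ (j + 1) * `|high_part J y (j, x)|.
  rewrite /high_part/=; case: ifP => _; last by rewrite mulr0 add0r.
  rewrite normr0 mulr0 addr0 expfzDr ?gt_eqF// expr1z mulrC -mulrA [b * _]mulrC.
  by rewrite ler_wpM2r// ltW// mulr_gt0.
apply: (@le_trans _ _ ((e * b ^ (J + 2)) +
    \sum_(k < n) synth_term (Num.norm \o high_part J y) k x)%:E%E).
  rewrite lee_fin; apply: (@le_trans _ _ (\sum_(k < n)
      (e * b * fold_int (fun j => if j <= J then b ^ j else 0) k +
       synth_term (Num.norm \o high_part J y) k x))).
    apply: ler_sum => k _.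
    apply: (le_trans (lerD (split_term (Posz k)) (split_term (Negz k)))).
    by rewrite addrACA -mulrDr.
  rewrite big_split/= lerD2r -mulr_sumr.
  have -> : e * b ^ (J + 2) = e * b * b ^ (J + 1).
    by rewrite -[2]/(1 + 1) addrA [b ^ (_ + 1)]expfzDr ?gt_eqF// expr1z; ring.
  by apply: ler_wpM2l; [rewrite mulr_ge0// ltW|exact: sum_low_powers].
rewrite EFinD leeD2l// -sumEFin -(big_mkord xpredT
  (fun k => (synth_term (Num.norm \o high_part J y) k x)%:E)).
by apply: nneseries_lim_ge => k _ _; rewrite lee_fin abs_synth_term_ge0.
Qed.

Lemma integral_abs_synth_le y (g : int -> R) (c : R) : slice_measurable y ->
  (forall j, (\int[mu]_x (b ^ (j + 1) * `|y (j, x)|)%:E <= (g j)%:E)%E) ->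
  (forall n, \sum_(k < n) fold_int g k <= c) -> (\int[mu]_x abs_synth y x <= c%:E)%E.
Proof.
move=> my yg gc; have term_ge0 j x : 0 <= b ^ (j + 1) * `|y (j, x)| by rewrite mulr_ge0// ltW.
have mterm j : measurable_fun setT (fun x => (b ^ (j + 1) * `|y (j, x)|)%:E).
  apply/measurable_EFinP; apply: measurable_funM => //.
  exact: (slice_measurable_norm my j).
rewrite /abs_synth integral_nneseries//; first last.
- by move=> k x _; rewrite lee_fin abs_synth_term_ge0.
- move=> k; rewrite /synth_term /fold_int/=; under eq_fun do rewrite EFinD.
  exact: emeasurable_funD.
apply: lime_le.
  apply: is_cvg_nneseries => k _ _; apply: integral_ge0 => x _.
  by rewrite lee_fin abs_synth_term_ge0.
apply: nearW => n; rewrite big_mkord; apply: (@le_trans _ _ (\sum_(k < n) fold_int g k)%:E).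
  rewrite -sumEFin; apply: lee_sum => k _; rewrite /synth_term /fold_int/=.
  under eq_integral do rewrite EFinD.
  rewrite EFinD ge0_integralD//; [by apply: leeD; exact: yg|by move=> x _; rewrite lee_fin..].
by rewrite lee_fin.
Qed.

Lemma integral_abs_synth_high y c s K (L : nat) : 0 < c -> 0 < s -> slope w s < b ^ K ->
  slice_measurable y -> (forall j, (\int[mu]_x `|y (j, x)|%:E <= c%:E * level j)%E) ->
  (\int[mu]_x abs_synth (high_part (K + L%:Z - 1) y) x
    <= (s * (2 * c * 2 ^- L * b ^ (K + 1)))%:E)%E.
Proof.
move=> c0 s0 sK my iy; set J := K + L%:Z - 1; pose D := c * s * b ^ (K + 1) * 2 ^ K.
have D0 : 0 <= D by rewrite !mulr_ge0 ?(ltW c0) ?(ltW s0) ?(ltW (bj _)) ?(ltW (exprz_gt0 _ _)).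
apply: (@integral_abs_synth_le _ (fun j => D * (if j <= J then 0 else 2 ^ (- j)))).
- exact: high_part_measurable.
- move=> j; rewrite /high_part/=; case: ifPn => [_|].
    by under eq_integral do rewrite normr0 mulr0; rewrite integral0 mulr0.
  rewrite -ltNge => Jj.
  have [m jE] : exists m : nat, j = K + m%:Z.
    exists `|j - K|%N; rewrite gez0_abs ?subrKC// subr_ge0.
    have : K + L%:Z <= j by rewrite -lezD1 /J subrK in Jj.
    by apply: le_trans; rewrite lerDl.
  under eq_integral do rewrite EFinM.
  rewrite ge0_integralZl//; [|exact: measurable_norm_EFin|by rewrite lee_fin ltW].
  apply: (@le_trans _ _ ((b ^ (j + 1))%:E * (c%:E * (s / N ^+ m)%:E))%E).
    apply: lee_wpmul2l; first by rewrite lee_fin ltW.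
    apply: (le_trans (iy j)); apply: lee_wpmul2l; first by rewrite lee_fin ltW.
    by rewrite jE; exact: level_decay.
  rewrite -!EFinM lee_fin le_eqVlt; apply/orP; left; apply/eqP.
  rewrite /D jE opprD !expfzDr ?gt_eqF// -exprnN -!exprnP -[2 ^ (- K)]invr_expz.
  have -> : N ^+ m = b ^+ m * 2 ^+ m by rewrite -exprMn divfK.
  have := exprn_gt0 m b0; have := exprn_gt0 m (ltr0n R 2); have := exprz_gt0 K (ltr0n R 2).
  move: (b ^+ m) (b ^ K) (2 ^ K) (2 ^+ m) => p q r t r0 t0 p0; field.
  by rewrite !gt_eqF.
- move=> n; apply: (@le_trans _ _ (D * 2 ^ (- J))).
    apply: le_trans (ler_wpM2l D0 (sum_high_powers R J n)).
    by rewrite mulr_sumr; apply: ler_sum => k _; rewrite /fold_int mulrDr.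
  rewrite le_eqVlt; apply/orP; left; apply/eqP.
  rewrite /D /J !opprD opprK !expfzDr ?gt_eqF// expr1z -exprnN -[2 ^ (- K)]invr_expz.
  have := exprn_gt0 L (ltr0n R 2); have := exprz_gt0 K (ltr0n R 2).
  move: (b ^ K) (2 ^ K) (2 ^+ L) => p q r q0 r0; field.
  by rewrite !gt_eqF.
Qed.

(* The scales up to [b ^ L] times [slope w t] are bounded by the supremum of [y], the others are
   controlled by the Markov inequality. *)
Lemma rearr_le_synth y e c (L : nat) : 0 <= e -> 0 < c -> slice_measurable y ->
  (forall u, `|y u| <= e) -> (forall j, (\int[mu]_x `|y (j, x)|%:E <= c%:E * level j)%E) ->
  rearr_le mu w (e * b ^+ (L + 3) + 2 * c * 2 ^- L * b ^+ 3) (synth y).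
Proof.
move=> e0 c0 my ye iy t a t0 ha; have [K [tK Kt]] := ex_exprz_above_slope t0.
pose J := K + L%:Z - 1; pose high := abs_synth (high_part J y).
have L0 : 0 < 2 ^- L :> R by rewrite invr_gt0 exprn_gt0.
pose r := 2 * c * 2 ^- L * b ^+ 3 * slope w t.
have r0 : 0 < r by rewrite mulr_gt0 ?(slope_gt0 dw)// !mulr_gt0 ?exprn_gt0.
have low_le : e * b ^ (J + 2) <= e * b ^+ (L + 3) * slope w t.
  rewrite -mulrA ler_wpM2l// (_ : J + 2 = (K + 1) + L%:Z); last by rewrite /J; ring.
  rewrite expfzDr ?gt_eqF// -exprnP exprD -mulrA mulrC ler_wpM2l//.
  by rewrite exprn_ge0 ?(ltW b0).
have mhigh : measurable_fun setT high by apply: measurable_abs_synth; exact: high_part_measurable.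
have := le_integral_abse mu measurableT mhigh r0.
under eq_integral do rewrite gee0_abs ?abs_synth_ge0//.
move=> /le_trans /(_ (integral_abs_synth_high L c0 t0 tK my iy)); rewrite setTI.
set A := [set x | (r%:E <= _)%E] => hA.
have mA : measurable A.
  by rewrite -(setTI A); apply: emeasurable_fun_c_infty => //; exact: measurableT_comp.
have mAt : (mu A <= t%:E)%E.
  rewrite -(@lee_pmul2l _ r%:E)//; apply: (le_trans hA).
  rewrite -EFinM lee_fin [leRHS]mulrC ler_wpM2l ?(ltW t0)// /r -[leRHS]mulrA ler_wpM2l//.
  by rewrite !mulr_ge0// ltW.
apply: le_trans mAt; apply: le_measure; rewrite ?inE//.
  by apply: measurable_norm_gt; exact: measurable_synth.
move=> x /= ax; rewrite /A/= gee0_abs ?abs_synth_ge0// leNgt; apply/negP => high_r.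
have := le_trans (norm_synth_le y x) (abs_synth_le_high J x e0 ye); rewrite -/(high x).
have high_fin : high x \is a fin_num.
  by rewrite ge0_fin_numE ?abs_synth_ge0// (lt_trans high_r) ?ltry.
move: high_r; rewrite -(fineK high_fin) lte_fin -EFinD lee_fin => high_r.
by apply/negP; rewrite -ltNge; move: ha; rewrite mulrDl -/r; lra.
Qed.

Lemma synth_dom_conull y : Y y -> mu.-negligible (~` synth_dom y).
Proof.
move=> [c c0 By]; have my := scaled_ball_measurable By.
have [K [tK _]] := ex_exprz_above_slope ltr01.
have high_le := integral_abs_synth_high 0 c0 ltr01 tK my (fun j => scaled_ball_integral_le j By).
set J := K + _ - 1 in high_le.
have high_int : mu.-integrable setT (abs_synth (high_part J y)).
  apply/integrableP; split; first by apply: measurable_abs_synth; exact: high_part_measurable.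
  under eq_integral do rewrite gee0_abs ?abs_synth_ge0//.
  by apply: (le_lt_trans high_le); rewrite ltry.
apply: negligibleS (integrable_ae measurableT high_int) => x /= yx.
apply: contra_not yx => /(_ I) high_fin.
apply: (le_lt_trans (abs_synth_le_high J x (ltW c0) (fun u => scaled_ball_norm_le u By))).
by rewrite lte_add_pinfty ?ltry// -ge0_fin_numE ?abs_synth_ge0.
Qed.

Definition slice f : int * T -> R := fun u =>
  \1_[set x | b ^ u.1 < `|f x| <= b ^ (u.1 + 1)] u.2 * (f u.2 / b ^ (u.1 + 1)).

Lemma norm_slice_le f j x : `|slice f (j, x)| <= \1_[set x | b ^ j < `|f x|] x.
Proof.
rewrite /slice !indicE/=; have [fj|nfj] := boolP (b ^ j < `|f x| <= b ^ (j + 1)).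
  have /andP[jf fj1] := fj.
  by rewrite !mem_set//= mul1r normrM normfV (gtr0_norm (bj _)) ler_pdivrMr// mul1r.
by rewrite memNset ?mul0r ?normr0//; exact/negP.
Qed.

Lemma slice_measurable_slice f : measurable_fun setT f -> slice_measurable (slice f).
Proof.
move=> mf j; rewrite /slice/=; apply: measurable_funM; last first.
  exact: (measurable_funM mf (measurable_cst (b ^ (j + 1))^-1)).
apply: measurable_indic.
rewrite (_ : mkset _ = [set x | b ^ j < `|f x|] `\` [set x | b ^ (j + 1) < `|f x|]).
  by apply: measurableD; exact: measurable_norm_gt.
apply/seteqP; split => x /=.
  by move=> /andP[jf fj]; split => //; apply/negP; rewrite -leNgt.
by move=> [jf /negP]; rewrite -leNgt => fj; exact/andP.
Qed.

Lemma slice_ball f : measurable_fun setT f -> rearr_le mu w 1 f -> B 1 (slice f).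
Proof.
move=> mf f1 j; split; first exact: slice_measurable_slice.
  by move=> x; apply: (le_trans (norm_slice_le f j x)); exact: indic_le1.
rewrite mul1e; apply: le_trans (measure_norm_gt_level j mf f1).
rewrite -[X in (_ <= mu X)%E]setIT -integral_indic//; last exact: measurable_norm_gt.
apply: ge0_le_integral_nonmeasurable => x _; first by rewrite lee_fin.
by rewrite lee_fin; exact: norm_slice_le.
Qed.

Lemma synth_slice f : synth (slice f) = f.
Proof.
apply/funext => x; have [fx0|fx0] := eqVneq (f x) 0.
  have slice0 j : slice f (j, x) = 0 by rewrite /slice/= fx0 mul0r mulr0.
  by rewrite (@synth_single _ _ 0) ?slice0// mulr0.
have normfx0 : 0 < `|f x| by rewrite normr_gt0.
have [j0 hj0] := ex_exprz_itv b1 normfx0.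
rewrite (@synth_single _ _ j0) => [|j jj0]; rewrite /slice indicE/=.
  by rewrite mem_set// mul1r mulrC divfK// gt_eqF.
rewrite memNset ?mul0r//= => hj; move/eqP : jj0; apply.
move: hj hj0 => /andP[h1 h2] /andP[h3 h4].
have := lt_le_trans h1 h4; have := lt_le_trans h3 h2.
rewrite !ltr_eXz2l// !ltzD1 => ? ?.
by apply/eqP; rewrite eq_le; apply/andP.
Qed.

End Synthesis.

(** * Duality of Marcinkiewicz spaces *)

Lemma not_cvg0_subsequence (R : realType) (u : nat -> R) : ~ (u n @[n --> \oo] --> 0) ->
  exists2 e : R, 0 < e & exists nu : nat -> nat,
    forall m, (m <= nu m)%N /\ e <= `|u (nu m)|.
Proof.
move=> ncv; apply: contrapT => nsub; apply: ncv; apply/cvgrPdist_lt => e e0.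
apply: contrapT => freq; apply: nsub; exists e => //.
suff /choice[nu hnu] m : exists n, (m <= n)%N /\ e <= `|u n| by exists nu.
apply: contrapT => h; apply: freq; exists m => // n /= mn.
by rewrite sub0r normrN ltNge; apply/negP => eu; apply: h; exists n.
Qed.

Section MarcinkiewiczDual.
Context {R : realType} {d : measure_display} {T : measurableType d}.
Variables (mu : {measure set T -> \bar R}) (psi w : R -> R) (N : R).
Hypotheses (mu_gt0 : (0 < mu setT)%E) (dw : doubling_weight w N)
  (psi_w : forall t, 0 < t -> (t%:E < mu setT)%E -> psi t <= w t <= 2 * psi t).
Local Notation b := (N / 2).
Local Notation B := (scaled_ball mu (level w N)).
Local Notation Y := (scaled_space mu (level w N)).
Local Notation M := (Mspace mu psi).
Local Notation syn := (synth N).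
Implicit Types (y z : int * T -> R) (f g : T -> R) (p : (T -> R) -> R).

Let N0 : 0 < N. Proof. exact: lt_le_trans (doubling_ge4 dw). Qed.
Let l0 := level_ge0 w N.
Let subY : linear_subspace Y := scaled_space_subspace mu l0.
Let subM : linear_subspace M := Mspace_subspace mu_gt0 dw psi_w.
Let BY y : B 1 y -> Y y. Proof. exact: scaled_ball_space. Qed.

Lemma Mdual_linear p : Mdual mu psi p -> linear_on M p.
Proof. by move=> [+ _]; exact. Qed.

Lemma Mdual_subspace : linear_subspace (Mdual mu psi).
Proof.
split.
  split; first by move=> c f g _ _; rewrite mulr0 addr0.
  by exists 0 => f _; rewrite normr0 mul0r.
move=> a p q [p_lin [C pC]] [q_lin [D qD]]; split.
  by move=> c f g Mf Mg; rewrite !fctE /GRing.scale/= p_lin// q_lin//; ring.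
exists (`|a| * C + D) => f Mf; apply: (le_trans (ler_normD _ _)).
rewrite mulrDl -mulrA; apply: lerD; last exact: qD.
by rewrite normrM ler_wpM2l// pC.
Qed.

Lemma Mdual_eq_ae p f g : Mdual mu psi p -> M f -> M g -> mu [set x | f x != g x] = 0%E ->
  p f = p g.
Proof.
move=> dp Mf Mg fg; have MB := linear_subspaceB subM Mf Mg.
apply/eqP; rewrite -subr_eq0 -(linear_onB (Mdual_linear dp))// -normr_le0.
have fg0 : rearr_le mu w 0 (f - g).
  apply: rearr_le_null; first exact: MB.1.
  by rewrite -[RHS]fg; congr (mu _); apply/seteqP; split => x /=; rewrite !fctE subr_eq0.
have [_ [C pC]] := dp; apply: (le_trans (pC _ MB)).
have := rearr_le_fine_Mnorm mu_gt0 dw psi_w (lexx 0) fg0; rewrite mulr0 => fine_le0.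
rewrite (_ : fine _ = 0) ?mulr0//; apply/eqP.
by rewrite eq_le fine_le0 (fine_Mnorm_ge0 mu_gt0 dw psi_w).
Qed.

Definition synth_bound c : R := c * b ^+ 3 + 2 * c * b ^+ 3.

Lemma rearr_le_synth_ball c y : 0 < c -> B c y -> rearr_le mu w (synth_bound c) (syn y).
Proof.
move=> c0 By; have := rearr_le_synth dw (L := 0%N) (ltW c0) c0 (scaled_ball_measurable By)
  (fun u => scaled_ball_norm_le u By) (fun j => scaled_ball_integral_le j By).
by rewrite add0n expr0 invr1 mulr1.
Qed.

Lemma synth_bound_ge0 c : 0 < c -> 0 <= synth_bound c.
Proof. by move=> c0; rewrite addr_ge0// !mulr_ge0 ?exprn_ge0 ?divr_ge0// ltW. Qed.

Lemma synth_space y : Y y -> M (syn y).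
Proof.
move=> Yy; have [c c0 By] := Yy; apply/(MspaceP mu_gt0 dw psi_w); split.
  by apply: (measurable_synth dw); exact: scaled_space_measurable Yy.
by exists (synth_bound c); [exact: synth_bound_ge0|exact: rearr_le_synth_ball].
Qed.

Lemma synth_fine_Mnorm_le y : B 1 y -> fine (Mnorm mu psi (syn y)) <= 2 * N * synth_bound 1.
Proof.
move=> By; apply: (rearr_le_fine_Mnorm mu_gt0 dw psi_w).
  exact: synth_bound_ge0.
exact: rearr_le_synth_ball.
Qed.

Lemma synth_onto_ball f : measurable_fun setT f -> (Mnorm mu psi f <= 1)%E ->
  exists2 y, B 1 y & syn y = f.
Proof.
move=> mf f1; exists (slice N f); last exact: (synth_slice dw).
by apply: (slice_ball dw) => //; exact: (Mnorm_rearr_le dw psi_w).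
Qed.

Lemma synth_flat e : 0 < e -> exists2 r, 0 < r &
  forall y, B 1 y -> (forall u, `|y u| <= r) -> exists2 z, B 1 z & syn y = e *: syn z.
Proof.
move=> e0; have b0 : 0 < b by rewrite divr_gt0.
have [L eL] : exists L : nat, 2 * 1 * 2 ^- L * b ^+ 3 <= e / 2.
  have [L hL] := exprn_unbounded (4 * b ^+ 3 / e) (ltr1n R 2 : 1 < 2).
  exists L; have L0 : 0 < 2 ^+ L :> R by rewrite exprn_gt0.
  by move: hL; rewrite ltr_pdivrMr// => hL; rewrite mulr1 mulrAC ler_pdivrMr//; lra.
pose r := e / 2 / b ^+ (L + 3).
have r0 : 0 < r by rewrite !divr_gt0// exprn_gt0.
exists r => // y By yr; have my := scaled_ball_measurable By.
have ye : rearr_le mu w e (syn y).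
  move=> t a t0 ha; apply: (rearr_le_synth dw (ltW r0) ltr01 my yr
    (fun j => scaled_ball_integral_le j By) (L := L)) => //; apply: le_lt_trans ha.
  by rewrite ler_wpM2r ?(ltW (slope_gt0 dw _))// divfK ?gt_eqF ?exprn_gt0//; lra.
exists (slice N (e^-1 *: syn y)); last first.
  by rewrite (synth_slice dw) scalerA divff ?scale1r// gt_eqF.
apply: (slice_ball dw); first by apply: measurable_funM => //; exact: (measurable_synth dw).
have e1 : e^-1 != 0 by rewrite gt_eqF// invr_gt0.
by have := rearr_leZ e1 ye; rewrite gtr0_norm ?invr_gt0// mulVf ?gt_eqF.
Qed.

Lemma Mdual_synth_linear p : Mdual mu psi p -> linear_on Y (p \o syn).
Proof.
move=> dp a y z Yy Yz /=; have Yw := subY.2 a y z Yy Yz.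
have [My Mz Mw] : [/\ M (syn y), M (syn z) & M (syn (a *: y + z))].
  by split; exact: synth_space.
have Mayz : M (a *: syn y + syn z) by exact: (subM.2 a _ _ My Mz).
apply: etrans (Mdual_linear dp a My Mz); apply: (Mdual_eq_ae dp Mw Mayz).
have conull v : Y v -> mu.-negligible (~` synth_dom N v) by exact: synth_dom_conull.
apply/negligibleP; last first.
  apply: negligibleS (negligibleU (negligibleU (conull _ Yy) (conull _ Yz)) (conull _ Yw)).
  move=> x /= neq; apply: contrapT => /not_orP[/not_orP[/contrapT yx /contrapT zx] /contrapT wx].
  by move/eqP : neq; apply; rewrite (synth_linear dw).
under eq_set do rewrite -subr_eq0 -normr_gt0.
apply: (measurable_norm_gt (f := fun x => _ - _)).
by apply: measurable_funB; [exact: Mw.1|exact: (subM.2 a _ _ My Mz).1].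
Qed.

Lemma Mdual_synth_bounded p : Mdual mu psi p ->
  exists C : R, forall y, B 1 y -> `|p (syn y)| <= C.
Proof.
move=> [_ [C pC]]; exists (`|C| * (2 * N * synth_bound 1)) => y By.
apply: (le_trans (pC _ (synth_space (BY By)))).
apply: (@le_trans _ _ (`|C| * fine (Mnorm mu psi (syn y)))).
  by rewrite ler_wpM2r ?ler_norm// (fine_Mnorm_ge0 mu_gt0 dw psi_w).
by rewrite ler_wpM2l// synth_fine_Mnorm_le.
Qed.

Lemma Mdualnorm_le p c : Mdual mu psi p -> (forall y, B 1 y -> `|p (syn y)| <= c) ->
  0 <= Mdualnorm mu psi p <= c.
Proof.
move=> dp pc; rewrite /Mdualnorm; set S := ereal_sup _.
have Sc : (S <= c%:E)%E.
  apply: ge_ereal_sup => _ [f [[mf _] f1] <-]; rewrite lee_fin.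
  by have [y By <-] := synth_onto_ball mf f1; exact: pc.
have S0 : (0 <= S)%E.
  apply: ereal_sup_ubound; exists 0; last first.
    by rewrite (linear_on0 subM (Mdual_linear dp)) normr0.
  split; first exact: linear_subspace0.
  apply: (le_trans (rearr_le_Mnorm dw psi_w (lexx 0) (@rearr_le0 _ _ _ mu w))).
  by rewrite mulr0 lee_fin.
rewrite fine_ge0//= -lee_fin fineK// ge0_fin_numE//.
exact: le_lt_trans Sc (ltry _).
Qed.

Section Bidual.
Variable Phi : ((T -> R) -> R) -> R.
Hypothesis bPhi : Mbidual mu psi Phi.

Lemma Mbidual_linear : linear_on (Mdual mu psi) Phi.
Proof. exact: bPhi.1. Qed.

Lemma Mbidual_bound : exists2 C : R, 0 < C & forall p c, Mdual mu psi p ->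
  (forall y, B 1 y -> `|p (syn y)| <= c) -> `|Phi p| <= C * c.
Proof.
have [_ [C PhiC]] := bPhi; exists (`|C| + 1) => [|p c dp pc]; first by rewrite ltr_wpDl.
have /andP[p0 p_le] := Mdualnorm_le dp pc.
apply: (le_trans (PhiC _ dp)); apply: (@le_trans _ _ (`|C| * Mdualnorm mu psi p)).
  by rewrite ler_wpM2r// ler_norm.
by rewrite ler_pM// lerDl.
Qed.

Lemma Mbidual_helly (chi : nat -> (T -> R) -> R) (e : R) : 0 < e ->
  (forall i, Mdual mu psi (chi i)) ->
  (exists D, forall i y, B 1 y -> `|chi i (syn y)| <= D) -> (forall i, e <= Phi (chi i)) ->
  exists2 e0 : R, 0 < e0 & jointly_large mu (level w N) (fun i => chi i \o syn) e0.
Proof.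
move=> e0 dchi chiD ePhi; have [C C0 PhiC] := Mbidual_bound.
have [D chi_le] := chiD; exists (e / 2 / C) => [|n]; first by rewrite !divr_gt0.
have [||||||y By close] := @helly _ 'I_n.+1 _ Y (B 1) (fun i => chi i \o syn)
  (fun i => Phi (chi i)) C (e / 2) _ _ _ subY _ _ C0 _ (divr_gt0 e0 (ltr0n _ 2)).
- by exists 0; exact: scaled_ball0.
- exact: scaled_ball_convex.
- exact: BY.
- by move=> i; exact: Mdual_synth_linear.
- by exists D => i y; exact: chi_le.
- move=> u c uc; pose p := \sum_i u i *: chi i.
  have dp : Mdual mu psi p.
    apply: (linear_subspace_sum Mdual_subspace) => i.
    exact: (linear_subspaceZ Mdual_subspace).
  have pE y : p (syn y) = \sum_i u i * chi i (syn y) by rewrite /p fct_sumE.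
  rewrite -(linear_on_sum Mdual_subspace Mbidual_linear)//.
  apply: le_trans (ler_norm _) _; apply: (PhiC p c dp) => y By.
  have pN : p (syn (- y)) = - p (syn y).
    exact: (linear_onN subY (Mdual_synth_linear dp) (BY By)).
  rewrite ler_norml lerNl -pN !pE uc ?uc//; exact: scaled_ballN.
exists y => // i ile; rewrite ler_pdivrMr// mulrC /=.
have := close (Ordinal (ile : (i < n.+1)%N)) => /=.
by have := ePhi i; move=> + /ltr_normlW; lra.
Qed.

Lemma Mbidual_cvg0 (chi : nat -> (T -> R) -> R) : (forall i, Mdual mu psi (chi i)) ->
  (forall f, M f -> chi i f @[i --> \oo] --> 0) -> Phi (chi i) @[i --> \oo] --> 0.
Proof.
move=> dchi chi0; apply: contrapT => /not_cvg0_subsequence[e e0 [nu hnu]].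
pose s m : R := if 0 <= Phi (chi (nu m)) then 1 else -1.
have norm_s m : `|s m| = 1 by rewrite /s; case: ifP; rewrite ?normrN normr1.
pose xi m := s m *: chi (nu m).
have dxi m : Mdual mu psi (xi m) by exact: (linear_subspaceZ Mdual_subspace).
have ePhi m : e <= Phi (xi m).
  rewrite (linear_onZ Mdual_subspace Mbidual_linear)//; apply: (le_trans (hnu m).2).
  rewrite /s; case: ifPn => [|/negbTE]; first by move=> ?; rewrite mul1r ger0_norm.
  by move=> /negbT; rewrite -ltNge => ?; rewrite mulN1r ltr0_norm.
have xi0 y : B 1 y -> (xi m \o syn) y @[m --> \oo] --> 0.
  move=> /BY/synth_space/chi0/cvgrPdist_lt chiy; apply/cvgrPdist_lt => c /chiy[n _ hn].
  exists n => // m /= nm; have := hn (nu m) (leq_trans nm (hnu m).1).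
  by rewrite !sub0r !normrN /xi fctE normrM norm_s mul1r.
have xi_lin m : linear_on Y (xi m \o syn) by exact: Mdual_synth_linear.
have [C C0 xiC] := scaled_ball_uniform_boundedness l0 xi_lin
  (fun m => Mdual_synth_bounded (dxi m)) xi0.
have [e1 e10 large] : exists2 e1 : R, 0 < e1 &
    jointly_large mu (level w N) (fun m => xi m \o syn) e1.
  by apply: (Mbidual_helly e0 dxi _ ePhi); exists C.
apply: (not_jointly_large l0 xi_lin xiC xi0 _ e10 large) => c c0.
have [r r0 flat] := synth_flat (divr_gt0 c0 C0); exists r => // m y By yr.
have [z Bz yz] := flat y By yr.
rewrite /= yz (linear_onZ subM (Mdual_linear (dxi m))); last exact/synth_space/BY.
by rewrite normrM gtr0_norm ?divr_gt0// mulrAC ler_pdivrMr// ler_wpM2l ?(ltW c0)// xiC.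
Qed.

End Bidual.

Lemma Marcinkiewicz_Grothendieck : Mpsi_Grothendieck mu psi.
Proof.
move=> phis phi dphis dphi phis_phi Phi bPhi.
have Phi_lin := Mbidual_linear bPhi.
have dchi n : Mdual mu psi (phis n - phi) by exact: (linear_subspaceB Mdual_subspace).
suff : Phi (phis n - phi) @[n --> \oo] --> 0.
  under eq_fun do rewrite (linear_onB Phi_lin)//.
  by move/subr_cvg0.
apply: Mbidual_cvg0 => // f Mf; rewrite -(subrr (phi f)).
by apply: cvgB; [exact: phis_phi|exact: cvg_cst].
Qed.

End MarcinkiewiczDual.

Theorem theorem6p3 (R : realType) (d : measure_display) (T : measurableType d)
  (mu : {measure set T -> \bar R}) (psi : R -> R) :
  sigma_finite setT mu ->
  (0 < mu setT)%E ->
  (* psi : [0, gamma) -> [0, oo) *)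
  (forall t, 0 <= t -> (t%:E < mu setT)%E -> 0 <= psi t) ->
  (* non-zero *)
  (exists t, [/\ 0 <= t, (t%:E < mu setT)%E & psi t != 0]) ->
  (* increasing (non-decreasing) on [0, gamma) *)
  (forall s t, 0 <= s -> s <= t -> (t%:E < mu setT)%E -> psi s <= psi t) ->
  (* concave on [0, gamma) *)
  concave_on [set t | 0 <= t /\ (t%:E < mu setT)%E] psi ->
  (* continuous on (0, gamma) *)
  (forall t, 0 < t -> (t%:E < mu setT)%E -> {for t, continuous psi}) ->
  psi 0 = 0 ->
  ((* condition (A) *)
   (mu setT = +oo%E /\ liminf0_gt1 psi /\ liminfoo_gt1 psi) \/
   (* condition (B) *)
   ((mu setT < +oo)%E /\ liminf0_gt1 psi)) ->
  Mpsi_Grothendieck mu psi.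
Proof.
move=> _ mu_gt0 psi_ge0 psi_neq0 psi_nd psi_concave _ psi0 growth.
have [w [N [dw psi_w]]] :=
  doubling_weight_majorant mu_gt0 psi_ge0 psi_neq0 psi_nd psi_concave psi0 growth.
exact: (Marcinkiewicz_Grothendieck mu_gt0 dw psi_w).
Qed.
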